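(* Let $(T_1,T_2)$ be a commuting contractive pair on $\mathcal H$ and $T=T_1T_2$. Then $(T_1,T_2)$ has a strongly minimal And\^o lift if and only if its Fundamental-Operator pair $(F_1,F_2)$ satisfies $$F_1F_2=0=F_2F_1,\qquad F_1^*F_1+F_2F_2^*=I_{\mathcal D_T}=F_1F_1^*+F_2^*F_2.$$
   Context: Commuting contractive pair: commuting operators of norm at most $1$. $D_T=(I-T^*T)^{1/2}$, $\mathcal D_T=\overline{\operatorname{Ran}}\,D_T$. The Fundamental-Operator pair of $(T_1,T_2)$ is the (existing and unique) pair $F_1,F_2\in\mathcal B(\mathcal D_T)$ with $T_1-T_2^*T=D_TF_1D_T$ and $T_2-T_1^*T=D_TF_2D_T$. And\^o lift of $(T_1,T_2)$: $(\Pi,V_1,V_2)$ with $\Pi:\mathcal H\to\mathcal K$ isometric and $(V_1,V_2)$ commuting isometries on $\mathcal K$ with $V_j^*\Pi=\Pi T_j^*$. It is strongly minimal if $\mathcal K=\bigvee_{n\ge0}V_1^nV_2^n\operatorname{Ran}\Pi$. *)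

(* Defs.v *)
From HB Require Import structures.
From mathcomp Require Import all_boot all_order all_algebra sesquilinear.
From mathcomp Require Import complex ring lra.
From mathcomp Require Import all_classical all_reals all_analysis.
Set Implicit Arguments.
Unset Strict Implicit.
Unset Printing Implicit Defensive.
Import Order.TTheory GRing.Theory Num.Theory.
Import numFieldNormedType.Exports.
Local Open Scope classical_set_scope.
Local Open Scope ring_scope.

(* Hilbert spaces are complex, of arbitrary
   dimension; inner products are linear in the first argument.  The norm of a
   normed module over [R[i]] takes its values in [R[i]] itself, and
   [x <= y] in [R[i]] means that [y - x] is real and nonnegative. *)
HB.mixin Record isHilbert (R : realType) H & CompleteNormedModule R[i] H := {
  inner : {dot H for @Num.conj R[i]};
  inner_norm : forall x : H, inner x x = `|x| ^+ 2
}.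

#[short(type="hilbertType")]
HB.structure Definition Hilbert (R : realType) :=
  {H of CompleteNormedModule R[i] H & isHilbert R H}.

#[short(type="boundedOp")]
HB.structure Definition BoundedOp (K : numFieldType) (U V : normedModType K) :=
  {f of @GRing.Linear K U V *:%R f & @isContinuous U V f}.

Section ops.
Context {K : numFieldType} {U V W : normedModType K}.
Implicit Types (f g : boundedOp U V) (h : boundedOp V W).

HB.instance Definition _ f h := Continuous.on (h \o f).
HB.instance Definition _ := @isContinuous.Build U U idfun (fun x => @cvg_id _ _).
HB.instance Definition _ f g := isContinuous.Build _ _ (f \- g)
  (fun x => continuousB (cts_fun x) (cts_fun x)).
End ops.

Section inner_theory.
Context {R : realType} {H : hilbertType R}.
Implicit Types (x y z : H) (a : R[i]).

Lemma innerDl x y z : inner (x + y) z = inner x z + inner y z.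
Proof. exact: linearDl. Qed.
Lemma innerDr x y z : inner x (y + z) = inner x y + inner x z.
Proof. exact: linearDr. Qed.
Lemma innerNl x y : inner (- x) y = - inner x y.
Proof. exact: linearNl. Qed.
Lemma innerNr x y : inner x (- y) = - inner x y.
Proof. exact: linearNr. Qed.
Lemma innerBl x y z : inner (x - y) z = inner x z - inner y z.
Proof. exact: linearBl. Qed.
Lemma innerBr x y z : inner x (y - z) = inner x y - inner x z.
Proof. exact: linearBr. Qed.
Lemma inner0l x : inner 0 x = 0. Proof. exact: linear0l. Qed.
Lemma inner0r x : inner x 0 = 0. Proof. exact: linear0r. Qed.
Lemma innerZl a x y : inner (a *: x) y = a * inner x y.
Proof. exact: linearZl_LR. Qed.
Lemma innerZr a x y : inner x (a *: y) = Num.conj a * inner x y.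
Proof. exact: linearZr_LR. Qed.
Lemma innerC x y : Num.conj (inner x y) = inner y x.
Proof. by rewrite [RHS]hermC expr0 mul1r. Qed.
Lemma inner_ge0 x : 0 <= inner x x.
Proof. by rewrite inner_norm exprn_ge0. Qed.
Lemma inner_eq0 x : (inner x x == 0) = (x == 0).
Proof. by rewrite inner_norm sqrf_eq0 normr_eq0. Qed.

Lemma inner_inj x y : (forall z, inner x z = inner y z) -> x = y.
Proof.
move=> e; apply/eqP; rewrite -subr_eq0 -inner_eq0 innerBl subr_eq0.
exact/eqP/e.
Qed.

Lemma cauchy_schwarz x y : `|inner x y| <= `|x| * `|y|.
Proof.
have [->|y0] := eqVneq y 0; first by rewrite inner0r !normr0 mulr0.
have ny0 : 0 < `|y| by rewrite normr_gt0.
rewrite -(@ler_pXn2r _ 2)// ?nnegrE ?mulr_ge0// normCK exprMn innerC.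
have := inner_ge0 (`|y| ^+ 2 *: x - inner x y *: y).
rewrite innerBl !innerBr !innerZl !innerZr !inner_norm -(innerC x y).
have -> : Num.conj (`|y| ^+ 2) = `|y| ^+ 2.
  by rewrite conj_Creal// rpredX// normr_real.
set n := `|y|; set m := `|x|; set c := inner x y; set d := Num.conj c.
have -> : n ^+ 2 * (n ^+ 2 * m ^+ 2) - n ^+ 2 * (d * c) -
  (c * (n ^+ 2 * d) - c * (d * n ^+ 2)) = n ^+ 2 * (m ^+ 2 * n ^+ 2 - c * d).
  by ring.
by rewrite pmulr_rge0 ?exprn_gt0// subr_ge0.
Qed.

Lemma parallelogram x y :
  `|x + y| ^+ 2 + `|x - y| ^+ 2 = 2 * `|x| ^+ 2 + 2 * `|y| ^+ 2.
Proof.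
rewrite -!inner_norm !(innerDl, innerDr, innerBl, innerBr, innerNl, innerNr).
by ring.
Qed.

End inner_theory.

Section norms.
Context {R : realType} {H : hilbertType R}.
Implicit Types (x y z : H).

Definition rnorm x : R := complex.Re `|x|.

Lemma rnormE x : `|x| = (rnorm x)%:C%C.
Proof. by rewrite RRe_real// normr_real. Qed.

Lemma rnorm_ge0 x : 0 <= rnorm x.
Proof. by rewrite -ler0c -rnormE. Qed.

Lemma rnorm_sqr x : inner x x = (rnorm x ^+ 2)%:C%C.
Proof. by rewrite inner_norm rnormE rmorphXn. Qed.

Lemma rnormD x y : rnorm (x + y) <= rnorm x + rnorm y.
Proof. by rewrite -lecR rmorphD/= -!rnormE ler_normD. Qed.

Lemma rnorm_eq0 x : rnorm x = 0 -> x = 0.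
Proof. by move=> e; apply/eqP; rewrite -normr_eq0 rnormE e. Qed.

Lemma Re_inner_le x y : complex.Re (inner x y) <= rnorm x * rnorm y.
Proof.
rewrite -lecR rmorphM/= -!rnormE (le_trans _ (cauchy_schwarz x y))//.
by rewrite (le_trans _ (normc_ge_Re _))// lecR ler_norm.
Qed.

Lemma complex_gt0 (e : R[i]) : 0 < e -> exists2 d : R, 0 < d & e = d%:C%C.
Proof.
move=> e0; have er : e \is Num.real by rewrite gtr0_real.
exists (complex.Re e); last by rewrite RRe_real.
by rewrite -ltcR RRe_real.
Qed.

Lemma hilbert_cauchy (u : nat -> H) :
  (forall e : R, 0 < e -> exists N, forall m n, (N <= m)%N -> (N <= n)%N ->
    rnorm (u m - u n) < e) -> exists l : H, u @ \oo --> l.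
Proof.
move=> hu; apply/cvg_ex.
apply/cauchy_cvgP/cauchy_exP => _ /complex_gt0[e e0 ->].
have [N hN] := hu e e0.
exists (u N), N => // n /= Nn.
by rewrite -ball_normE/ball_/= rnormE ltcR hN.
Qed.

Lemma rnorm_cvg (u : nat -> H) l : u @ \oo --> l ->
  forall e : R, 0 < e -> exists N, forall n, (N <= n)%N -> rnorm (l - u n) < e.
Proof.
move=> /cvgrPdist_lt ul e e0.
have [|N _ hN] := ul e%:C%C; first by rewrite ltcR.
by exists N => n Nn; have := hN n Nn; rewrite rnormE ltcR.
Qed.

End norms.

Section riesz.
Context {R : realType} {H : hilbertType R}.
Variables (phi : H -> R[i]) (M : R).
Hypothesis phiL : forall a x y, phi (a *: x + y) = a * phi x + phi y.
Hypothesis phiM : forall x, `|phi x| <= M%:C%C * `|x|.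

Local Notation Re := complex.Re.
Let J x : R := rnorm x ^+ 2 - 2 * Re (phi x).

Let Rephi x : Re (phi x) <= M * rnorm x.
Proof.
rewrite -lecR rmorphM/= -rnormE (le_trans _ (phiM x))//.
by rewrite (le_trans _ (normc_ge_Re _))// lecR ler_norm.
Qed.

Let J_lb x : - M ^+ 2 <= J x.
Proof. by have := Rephi x; have := sqr_ge0 (rnorm x - M); rewrite /J; lra. Qed.

Let J_line x h (t : R) : J (x + t%:C%C *: h) =
  J x + t ^+ 2 * rnorm h ^+ 2 + 2 * t * (Re (inner h x) - Re (phi h)).
Proof.
rewrite /J; have -> : rnorm (x + t%:C%C *: h) ^+ 2 =
    rnorm x ^+ 2 + t ^+ 2 * rnorm h ^+ 2 + 2 * t * Re (inner h x).
  apply: complexI; rewrite -rnorm_sqr innerDl !innerDr !innerZl !innerZr.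
  rewrite !rnorm_sqr -(innerC h x); case: (inner h x) => a b.
  by apply/eqP; rewrite eq_complex /=; apply/andP; split; apply/eqP; simpc; ring.
rewrite [x + _]addrC phiL; have -> : Re (t%:C%C * phi h + phi x) = t * Re (phi h) + Re (phi x).
  by case: (phi h) (phi x) => a b [c d]; simpc.
ring.
Qed.

Lemma riesz : exists y, forall x, phi x = inner x y.
Proof.
pose E := range J; pose m := inf E.
have infE : has_inf E.
  by split; [exists (J 0), 0|exists (- M ^+ 2) => _ [x _ <-]].
have mJ x : m <= J x by apply: ge_inf; [exact: infE.2|exists x].
have /choice[u uJ] n : exists x, J x < m + n.+1%:R^-1.
  have [|_ [x _ <-] Jx] := @inf_adherent _ E n.+1%:R^-1 _ infE.
    by rewrite invr_gt0.
  by exists x.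
have Jpar x y : rnorm (x - y) ^+ 2 <= 2 * (J x - m + (J y - m)).
  have := J_line y (x - y) 1; have := J_line y (x - y) 2^-1.
  rewrite rmorph1 scale1r [y + (x - y)]addrC subrK.
  have := mJ (y + (2^-1)%:C%C *: (x - y)).
  by move=> + e1 e2; rewrite e1 e2; lra.
have small (e : R) : 0 < e -> exists N, forall n, (N <= n)%N -> n.+1%:R^-1 < e.
  move=> e0; have [N _ hN] := near_infty_natSinv_lt (PosNum e0).
  by exists N => n Nn; exact: hN.
have [|l ul] := hilbert_cauchy (u := u).
  move=> e e0; have [|N hN] := small (e ^+ 2 / 4); first by rewrite divr_gt0 ?exprn_gt0.
  exists N => p q Np Nq; rewrite -(@ltr_pXn2r _ 2)// ?nnegrE ?rnorm_ge0 ?ltW//.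
  apply: (le_lt_trans (Jpar _ _)).
  move: (uJ p) (uJ q) (hN _ Np) (hN _ Nq).
  by move: (p.+1%:R^-1) (q.+1%:R^-1) (e ^+ 2) => a b c; lra.
have Jl : J l <= m.
  apply/ler_addgt0Pr => e e0.
  pose C := 1 + 2 * (rnorm l + `|M|).
  have C0 : 0 < C by have := rnorm_ge0 l; have := normr_ge0 M; rewrite /C; lra.
  have eC : 0 < e / C by rewrite divr_gt0.
  have [N1 hN1] := small _ eC; have [N2 hN2] := rnorm_cvg ul eC.
  pose n := maxn N1 N2.
  have {}hN1 := hN1 n (leq_maxl _ _); have {}hN2 := hN2 n (leq_maxr _ _).
  have := J_line l (u n - l) 1; rewrite rmorph1 scale1r [l + _]addrC subrK => Ju.
  have i1 : - Re (inner (u n - l) l) <= rnorm (l - u n) * rnorm l.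
    by apply: le_trans (Re_inner_le _ _); rewrite -opprB innerNl raddfN opprK.
  have i2 : Re (phi (u n - l)) <= M * rnorm (u n - l) by exact: Rephi.
  have nE : rnorm (u n - l) = rnorm (l - u n) by rewrite /rnorm distrC.
  have eE : e = (e / C) * C by rewrite divfK ?gt_eqF.
  rewrite eE; rewrite nE in i2 Ju.
  have := rnorm_ge0 l; have := rnorm_ge0 (l - u n); have := uJ n.
  have Mle : M * rnorm (l - u n) <= `|M| * rnorm (l - u n).
    by rewrite ler_wpM2r ?rnorm_ge0// ler_norm.
  have := normr_ge0 M; move: hN1 hN2 eC Mle i1 i2 Ju.
  set d := e / C => hN1 hN2 d0 Mle i1 i2 Ju aM0 uJn r0 s0; rewrite /C.
  have p1 : rnorm (l - u n) * rnorm l <= d * rnorm l.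
    by rewrite ler_wpM2r// ltW.
  have p2 : `|M| * rnorm (l - u n) <= `|M| * d by rewrite ler_wpM2l// ltW.
  have p3 := sqr_ge0 (rnorm (l - u n)).
  move: uJn hN1; move: (n.+1%:R^-1) => k uJn hN1; lra.
have crit h : Re (inner h l) = Re (phi h).
  pose c := Re (inner h l) - Re (phi h).
  suff : c = 0 by move/eqP; rewrite subr_eq0 => /eqP.
  pose b := rnorm h ^+ 2 + 1.
  have b0 : 0 < b by rewrite ltr_wpDl// sqr_ge0.
  have := J_line l h (- c / b); rewrite -/c => e.
  have := mJ (l + (- c / b)%:C%C *: h); rewrite e => {}e.
  have k0 : 0 <= (- c / b) ^+ 2 * rnorm h ^+ 2 + 2 * (- c / b) * c by lra.
  apply/eqP; rewrite -sqrf_eq0 eq_le sqr_ge0 andbT.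
  have bE : (- c / b) ^+ 2 * b = c ^+ 2 / b by field; rewrite gt_eqF.
  have cE : (- c / b) * c = - (c ^+ 2 / b) by field; rewrite gt_eqF.
  have : c ^+ 2 / b <= 0.
    have := sqr_ge0 (- c / b); move: k0; rewrite -mulrA cE.
    have -> : rnorm h ^+ 2 = b - 1 by rewrite /b addrK.
    by rewrite mulrBr bE mulr1; lra.
  by rewrite pmulr_lle0// invr_gt0.
exists l => h; apply/eqP; rewrite eq_complex crit eqxx/=.
have phiZ a x : phi (a *: x) = a * phi x.
  have p0 : phi 0 = 0.
    have /eqP := phiL 1 0 0; rewrite scale1r addr0 mul1r.
    by rewrite eq_sym -subr_eq0 addrK => /eqP.
  by rewrite -[a *: x]addr0 phiL p0 addr0.
have := crit (Complex 0 1 *: h); rewrite innerZl phiZ.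
by case: (inner h l) (phi h) => a b [c d] /=; rewrite !mul0r !mul1r !sub0r => /oppr_inj ->.
Qed.
End riesz.

Section mkop.
Context {K : numFieldType} {U V : normedModType K}.
Variables (f : U -> V) (fL : linear f) (M : K).
Hypotheses (M0 : 0 <= M) (fM : forall x, `|f x| <= M * `|x|).

Definition mkop_fun : U -> V := f.
HB.instance Definition _ := GRing.isLinear.Build K U V *:%R mkop_fun fL.
Let mkop_continuous : continuous mkop_fun.
Proof.
apply/bounded_linear_continuous/linear_boundedP; near=> r => x.
apply: le_trans (fM x) _; rewrite ler_wpM2r//; near: r.
by apply: nbhs_pinfty_ge; rewrite ger0_real.
Unshelve. all: by end_near. Qed.
HB.instance Definition _ := isContinuous.Build U V mkop_fun mkop_continuous.
Definition mkop : boundedOp U V := mkop_fun.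
Lemma mkopE x : mkop x = f x. Proof. by []. Qed.
End mkop.

Lemma op_bound (K : numFieldType) (U V : normedModType K)
    (T : boundedOp U V) :
  exists2 M : K, 0 < M & forall x, `|T x| <= M * `|x|.
Proof.
have := @cts_fun _ _ T; move/linear_bounded_continuous/linear_boundedP.
by move=> /pinfty_ex_gt0[M M0 TM]; exists M.
Qed.

Section adjoint.
Context {R : realType} {H K : hilbertType R}.

Lemma adjoint_exists (T : boundedOp H K) :
  exists S : boundedOp K H, forall x y, inner (T x) y = inner x (S y).
Proof.
have [M M0 TM] := op_bound T.
have /choice[S TS] (y : K) : exists z, forall x, inner (T x) y = inner x z.
  have [L L0 LE] : exists2 L : R, 0 <= L & M * `|y| = L%:C%C.
    exists (complex.Re (M * `|y|)); last first.
      by rewrite RRe_real// ger0_real// mulr_ge0// ltW.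
    by rewrite -lecR RRe_real ?ger0_real// mulr_ge0// ltW.
  apply: (@riesz _ _ _ L) => [a u v|x].
    by rewrite linearP innerDl innerZl.
  rewrite (le_trans (cauchy_schwarz _ _))// -LE mulrAC.
  by rewrite ler_wpM2r.
have Slin : linear S.
  move=> a u v; apply/esym/inner_inj => z.
  rewrite -[LHS]innerC -[RHS]innerC innerDr innerZr -!TS.
  by rewrite innerDr innerZr.
have SM y : `|S y| <= M * `|y|.
  have [->|Sy0] := eqVneq (S y) 0; first by rewrite normr0 mulr_ge0// ltW.
  have nS : 0 < `|S y| by rewrite normr_gt0.
  rewrite -(ler_pM2l nS) -expr2 -inner_norm -TS.
  have TS0 : 0 <= inner (T (S y)) y by rewrite TS inner_ge0.
  rewrite -(ger0_norm TS0); apply: (le_trans (cauchy_schwarz _ _)).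
  by rewrite mulrA [_ * M]mulrC ler_wpM2r.
by exists (mkop Slin (ltW M0) SM).
Qed.

Definition adj (T : boundedOp H K) : boundedOp K H :=
  projT1 (cid (adjoint_exists T)).

Lemma adjP (T : boundedOp H K) x y : inner (T x) y = inner x (adj T y).
Proof. by rewrite /adj; case: cid => S /= ->. Qed.

End adjoint.

Section positive.
Context {R : realType} {H : hilbertType R}.
Implicit Types (A B S : boundedOp H H) (x y z : H).

Let AD A x y : A (x + y) = A x + A y. Proof. exact: linearD. Qed.
Let AB A x y : A (x - y) = A x - A y. Proof. exact: linearB. Qed.
Let AZ A a x : A (a *: x) = a *: A x. Proof. exact: linearZ. Qed.

(* In a complex space this implies that [A] is self-adjoint, see [positive_sym]. *)
Definition positive_op A := forall x, 0 <= inner (A x) x.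

Definition commuting A B := A \o B =1 B \o A.

Lemma positive_sym A : positive_op A ->
  forall x y, inner (A x) y = inner x (A y).
Proof.
move=> A0; pose s x y := inner (A x) y - inner x (A y).
have sxx x : s x x = 0.
  apply/eqP; rewrite subr_eq0 -[X in _ == X]innerC.
  by rewrite conj_Creal// ger0_real.
have sD x y : s x y + s y x = 0.
  have -> : s x y + s y x = s (x + y) (x + y) - s x x - s y y.
    by rewrite /s AD !(innerDl, innerDr); ring.
  by rewrite !sxx !subr0.
move=> x y; apply/eqP; rewrite -subr_eq0 -/(s x y).
have := sD x (Complex 0 1 *: y).
have cE : Num.conj (Complex 0 1 : R[i]) = - Complex 0 1.
  by apply/eqP; rewrite eq_complex/= oppr0 !eqxx.
rewrite /s AZ !(innerZl, innerZr) cE.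
rewrite -/(s x y) => e.
have : Complex 0 1 * (s y x - s x y) = 0.
  by rewrite -[RHS]e /s; ring.
move/eqP; rewrite mulf_eq0 eq_complex/= oner_eq0 andbF/= subr_eq0 => /eqP yx.
have := sD x y; rewrite yx -mulr2n => /eqP.
by rewrite mulrn_eq0/=.
Qed.

(* For A <= k we have k^-1 A^2 <= A, whence |(1 - k^-1 A) x| <= |x|. *)
Lemma positive_bound A : positive_op A -> exists2 k : R[i], 0 < k &
  (forall x, `|A x| ^+ 2 <= k * inner (A x) x) /\
  (forall x, `|x - k^-1 *: A x| <= `|x|).
Proof.
move=> A0; have [k k0 Ak] := op_bound A; exists k => //.
have As := positive_sym A0.
have kr : Num.conj k = k by rewrite conj_Creal// gtr0_real.
have kVr : Num.conj k^-1 = k^-1 by rewrite conj_Creal// realV gtr0_real.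
have kn : k != 0 by rewrite gt_eqF.
have Ale x : inner (A x) x <= k * `|x| ^+ 2.
  rewrite -(ger0_norm (A0 x)) (le_trans (cauchy_schwarz _ _))//.
  by rewrite expr2 mulrA ler_wpM2r.
have AA x : `|A x| ^+ 2 <= k * inner (A x) x.
  have h1 := A0 (k *: x - A x); have := Ale (A x).
  rewrite -inner_norm => h2.
  have h3 : 0 <= inner (A (k *: x - A x)) (k *: x - A x) +
     (k * inner (A x) (A x) - inner (A (A x)) (A x)).
    by rewrite addr_ge0// subr_ge0.
  rewrite -subr_ge0 -(pmulr_rge0 _ k0); apply: le_trans h3 _.
  rewrite AB AZ !(innerBl, innerBr, innerZl, innerZr) kr.
  rewrite (As (A x) x) le_eqVlt; apply/orP; left; apply/eqP; ring.
split=> // x; rewrite -(@ler_pXn2r _ 2)// ?nnegrE// -!inner_norm.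
rewrite !(innerBl, innerBr, innerZl, innerZr) kVr -(As x x).
have h : k^-1 * (k^-1 * inner (A x) (A x)) <= k^-1 * inner (A x) x.
  by rewrite ler_pM2l ?invr_gt0// -(ler_pM2l k0) mulVKf// inner_norm AA.
rewrite -subr_ge0; set a := k^-1 * (_ * _).
set b := k^-1 * inner _ x.
have -> : inner x x - (inner x x - b - (b - a)) = b + (b - a) by ring.
by rewrite addr_ge0 ?subr_ge0// mulr_ge0 ?A0// invr_ge0 ltW.
Qed.

Lemma positive_eq0 A x : positive_op A -> inner (A x) x = 0 -> A x = 0.
Proof.
move=> A0 Ax; have [k k0 [Ak _]] := positive_bound A0.
have := Ak x; rewrite Ax mulr0 => Ale.
by apply/eqP; rewrite -normr_eq0 -sqrf_eq0 eq_le Ale exprn_ge0.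
Qed.

End positive.

Section inner_cvg.
Context {R : realType} {H : hilbertType R}.

Lemma inner_cvgl (u : nat -> H) (l y : H) :
  u @ \oo --> l -> inner (u n) y @[n --> \oo] --> inner l y.
Proof.
move=> ul; apply/cvgrPdist_lt => e e0.
have d0 : 0 < e / (`|y| + 1) by rewrite divr_gt0// ltr_wpDl.
have [N _ hN] := (cvgrPdist_lt _ _).1 ul _ d0.
exists N => // n /= Nn; rewrite -innerBl.
apply: le_lt_trans (cauchy_schwarz _ _) _.
apply: (@le_lt_trans _ _ (`|l - u n| * (`|y| + 1))).
  by rewrite ler_wpM2l// lerDl.
by rewrite -ltr_pdivlMr ?hN// ltr_wpDl.
Qed.

Lemma inner_cvgr (u : nat -> H) (l y : H) :
  u @ \oo --> l -> inner y (u n) @[n --> \oo] --> inner y l.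
Proof.
move=> ul; have := inner_cvgl (y := y) ul => /cvgrPdist_lt h; apply/cvgrPdist_lt => e e0.
have [N _ hN] := h _ e0; exists N => // n /= Nn.
by rewrite -innerBr -innerC norm_conjC innerBl; exact: hN.
Qed.

End inner_cvg.

(* The square root of [1 - Q], for [0 <= Q <= 1], is [1 - L] with
   [L = (Q + L^2) / 2] obtained by iterating from 0. *)
Section sqrt_iter.
Context {R : realType} {H : hilbertType R}.
Variable Q : boundedOp H H.
Hypothesis Qsym : forall x y, inner (Q x) y = inner x (Q y).
Hypothesis Qle1 : forall x, `|Q x| <= `|x|.

Fixpoint sqrt_iter n : H -> H :=
  if n is m.+1 then fun x => 2^-1 *: (Q x + sqrt_iter m (sqrt_iter m x))
  else fun=> 0.

Local Notation Y := sqrt_iter.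

Let Ylin n a x y : Y n (a *: x + y) = a *: Y n x + Y n y.
Proof.
elim: n a x y => [|n IH] a x y /=; first by rewrite scaler0 addr0.
have -> : Q (a *: x + y) = a *: Q x + Q y by exact: linearP.
by rewrite !IH addrACA -scalerDr [LHS]scalerDr !scalerA [2^-1 * a]mulrC.
Qed.

Let Y0 n : Y n 0 = 0.
Proof. by have := Ylin n (-1) 0 0; rewrite scaler0 addr0 scaleN1r addNr. Qed.

Let YB n x y : Y n (x - y) = Y n x - Y n y.
Proof. by rewrite addrC -scaleN1r Ylin scaleN1r addrC. Qed.

Let Ycomm (B : H -> H) : linear B -> (forall x, B (Q x) = Q (B x)) ->
  forall n x, B (Y n x) = Y n (B x).
Proof.
move=> BL BQ; pose B' : {linear H -> H} := HB.pack B (GRing.isLinear.Build R[i] H H *:%R B BL).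
elim=> [|n IH] x /=; first exact: (linear0 B').
by rewrite -(IH x) -IH -BQ [LHS](linearZ_LR B') (linearD B').
Qed.

Let YY m n x : Y m (Y n x) = Y n (Y m x).
Proof.
apply: Ycomm => [a u v|{}x]; first exact: Ylin.
by apply/esym/Ycomm => // a u v; rewrite linearP.
Qed.

Let Ysym n x y : inner (Y n x) y = inner x (Y n y).
Proof.
elim: n x y => [|n IH] x y /=; first by rewrite inner0l inner0r.
rewrite innerZl innerZr innerDl innerDr Qsym !IH.
by rewrite conj_Creal// realV realn.
Qed.

Fixpoint sqrt_iterR n : R :=
  if n is m.+1 then (1 + sqrt_iterR m ^+ 2) / 2 else 0.
Local Notation y := sqrt_iterR.

Let y01 n : 0 <= y n <= 1.
Proof. by elim: n => [|n IH] /=; [lra|nra]. Qed.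

Let ylim n : (1 - y n) * n.+2%:R <= 2.
Proof.
elim: n => [|n]; first by rewrite /=; lra.
rewrite -[in n.+3%:R]natr1 [y n.+1]/=; have := y01 n.
move: (n.+2%:R : R) (y n) => k t t01 h.
have : 0 <= (2 - (1 - t) * k) * (1 + t) by rewrite mulr_ge0//; lra.
have := sqr_ge0 (1 - t); nra.
Qed.

Let scaleV2 (x : H) : rnorm (2^-1 *: x) = rnorm x / 2.
Proof.
apply: complexI; rewrite -rnormE normrZ rnormE rmorphM/= fmorphV rmorph_nat mulrC.
by rewrite ger0_norm// invr_ge0.
Qed.

Let Qr x : rnorm (Q x) <= rnorm x.
Proof. by rewrite -lecR -!rnormE. Qed.

Let Yb n x : rnorm (Y n x) <= y n * rnorm x.
Proof.
elim: n x => [|n IH] x /=.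
  by rewrite /rnorm normr0 mul0r.
rewrite scaleV2; have := rnormD (Q x) (Y n (Y n x)); have := Qr x.
have := IH (Y n x); have := ler_wpM2l (proj1 (andP (y01 n))) (IH x).
by move=> h1 h2 h3 h4; lra.
Qed.

Let Ystep n x : rnorm (Y n.+1 x - Y n x) <= (y n.+1 - y n) * rnorm x.
Proof.
elim: n x => [|n IH] x.
  rewrite /= !subr0 addr0 scaleV2; have := Qr x; lra.
have -> : Y n.+2 x - Y n.+1 x =
    2^-1 *: (Y n.+1 (Y n.+1 x - Y n x) + Y n (Y n.+1 x - Y n x)).
  rewrite !YB (YY n n.+1 x) addrA subrK.
  transitivity (2^-1 *: (Q x + Y n.+1 (Y n.+1 x)) - 2^-1 *: (Q x + Y n (Y n x))).
    by [].
  by rewrite -scalerBr opprD addrACA subrr add0r.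
rewrite scaleV2.
set z := Y n.+1 x - Y n x.
have h1 := Yb n.+1 z; have h2 := Yb n z; have h3 := rnormD (Y n.+1 z) (Y n z).
have h4 := ler_wpM2l (proj1 (andP (y01 n.+1))) (IH x).
have h5 := ler_wpM2l (proj1 (andP (y01 n))) (IH x).
have E m : y m.+1 = (1 + y m ^+ 2) / 2 by [].
have -> : y n.+2 - y n.+1 = (y n.+1 ^+ 2 - y n ^+ 2) / 2.
  by rewrite (E n.+1) {2}(E n); ring.
move: h1 h2 h3 h4 h5; rewrite -/z; move: (rnorm x) (rnorm z) (y n.+1) (y n).
by move=> a b c d h1 h2 h3 h4 h5; lra.
Qed.

Let Ydist n m x : rnorm (Y (m + n) x - Y n x) <= (y (m + n) - y n) * rnorm x.
Proof.
elim: m => [|m IH]; first by rewrite !subrr mul0r /rnorm normr0.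
have -> : Y (m.+1 + n) x - Y n x =
    Y (m + n).+1 x - Y (m + n) x + (Y (m + n) x - Y n x).
  by rewrite addrA subrK.
by have := Ystep (m + n) x; have := rnormD (Y (m + n).+1 x - Y (m + n) x)
  (Y (m + n) x - Y n x); rewrite addSn; lra.
Qed.

Let Ydist1 n m x : (n <= m)%N -> rnorm (Y m x - Y n x) <= (1 - y n) * rnorm x.
Proof.
move=> nm; have := Ydist n (m - n) x; rewrite subnK// => h.
apply: (le_trans h); rewrite ler_wpM2r ?rnorm_ge0//.
by have := y01 m; lra.
Qed.

Let ysmall (e : R) : 0 < e -> exists n, 1 - y n < e.
Proof.
move=> e0; have e20 : 0 < e / 2 by rewrite divr_gt0.
have [N _ hN] := near_infty_natSinv_lt (PosNum e20).
exists N; have := hN N (leqnn _) => /= h.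
have := ylim N; rewrite -ler_pdivlMr// => h'; apply: (le_lt_trans h').
have : N.+2%:R^-1 <= N.+1%:R^-1 :> R by rewrite lef_pV2 ?posrE// ler_nat.
by move: h; move: (N.+1%:R^-1) (N.+2%:R^-1) => a b; lra.
Qed.

Let Ycvg x : exists l : H, Y n x @[n --> \oo] --> l.
Proof.
apply: hilbert_cauchy => e e0.
have c0 : 0 < 2 * (rnorm x + 1) by have := rnorm_ge0 x; lra.
have [N hN] := ysmall (divr_gt0 e0 c0).
exists N => m n Nm Nn; move: hN; rewrite ltr_pdivlMr// => hN.
have hm := Ydist1 x Nm; have hn := Ydist1 x Nn.
have -> : Y m x - Y n x = Y m x - Y N x + (Y N x - Y n x) by rewrite addrA subrK.
have := rnormD (Y m x - Y N x) (Y N x - Y n x).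
have -> : rnorm (Y N x - Y n x) = rnorm (Y n x - Y N x) by rewrite /rnorm distrC.
by have := y01 N; lra.
Qed.

Let L x : H := projT1 (cid (Ycvg x)).
Let LE x : Y n x @[n --> \oo] --> L x.
Proof. by rewrite /L; case: cid. Qed.

Let Ldist n x : rnorm (L x - Y n x) <= (1 - y n) * rnorm x.
Proof.
apply/ler_addgt0Pr => e e0; have [N hN] := rnorm_cvg (@LE x) e0.
have := hN (maxn n N) (leq_maxr _ _); have := Ydist1 x (leq_maxl n N).
have := rnormD (L x - Y (maxn n N) x) (Y (maxn n N) x - Y n x).
by rewrite addrA subrK; lra.
Qed.

Let Llin : linear L.
Proof.
move=> a u v; apply: (cvg_unique (@norm_hausdorff _ H) (@LE _)).
have -> : (fun n => Y n (a *: u + v)) = (fun n => a *: Y n u + Y n v).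
  by apply/funext => n; rewrite Ylin.
by apply: cvgD; [apply: cvgZl_tmp; exact: LE|exact: LE].
Qed.

Let L1 x : rnorm (L x) <= rnorm x.
Proof. by have := Ldist 0 x; rewrite /= !subr0 mul1r. Qed.

Let Lsym x z : inner (L x) z = inner x (L z).
Proof.
have h1 := inner_cvgl (y := z) (@LE x).
have h2 : inner (Y n x) z @[n --> \oo] --> inner x (L z).
  under eq_fun do rewrite Ysym.
  exact: inner_cvgr.
exact: (cvg_unique _ h1 h2).
Qed.

Let LL x : 2^-1 *: (Q x + L (L x)) = L x.
Proof.
suff h : Y n x @[n --> \oo] --> 2^-1 *: (Q x + L (L x)).
  exact: (cvg_unique _ h (@LE x)).
rewrite -cvg_shiftS/=; apply: cvgZl_tmp; apply: cvgD; first exact: cvg_cst.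
apply/cvgrPdist_lt => _ /complex_gt0[e e0 ->].
have c0 : 0 < 2 * (rnorm x + 1) by have := rnorm_ge0 x; lra.
have [N hN] := ysmall (divr_gt0 e0 c0).
exists N => // n /= Nn; rewrite rnormE ltcR.
move: hN; rewrite ltr_pdivlMr// => hN.
have -> : L (L x) - Y n (Y n x) = L (L x) - Y n (L x) + Y n (L x - Y n x).
  by rewrite YB addrA subrK.
have h1 := rnormD (L (L x) - Y n (L x)) (Y n (L x - Y n x)).
have ynN : 1 - y n <= 1 - y N.
  have := y01 N; have := y01 n => _ _.
  have mono m : y m <= y m.+1.
    by rewrite /=; have := sqr_ge0 (1 - y m); lra.
  by rewrite lerB// -(subnK Nn); elim: (n - N)%N => // k /le_trans; apply; exact: mono.
have h2 : rnorm (L (L x) - Y n (L x)) <= (1 - y N) * rnorm x.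
  apply: (le_trans (Ldist _ _)); rewrite ler_pM ?rnorm_ge0//.
  by have := y01 n; lra.
have h3 : rnorm (Y n (L x - Y n x)) <= (1 - y N) * rnorm x.
  apply: (le_trans (Yb _ _)); apply: (@le_trans _ _ (1 * rnorm (L x - Y n x))).
    by rewrite ler_wpM2r ?rnorm_ge0//; have := y01 n; lra.
  by rewrite mul1r (le_trans (Ldist _ _))// ler_wpM2r ?rnorm_ge0.
by have := y01 N; lra.
Qed.

Lemma sqrt_iter_lim : exists S : boundedOp H H,
  [/\ positive_op S, forall x, S (S x) = x - Q x &
      forall B : boundedOp H H, (forall x, B (Q x) = Q (B x)) -> commuting B S].
Proof.
have L1' x : `|L x| <= 1 * `|x| by rewrite mul1r !rnormE lecR.
pose L' := mkop Llin ler01 L1'.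
exists (idfun \- L'); split => [x|x|B BQ x].
- change (0 <= inner (x - L x) x); rewrite innerBl; have r : Num.conj (inner (L x) x) = inner (L x) x.
    by rewrite innerC Lsym.
  have /complex_realP[k kE] : inner (L x) x \is Num.real.
    by rewrite CrealE r.
  have := Re_inner_le (L x) x; rewrite kE/= rnorm_sqr subr_ge0 lecR => h.
  apply: (le_trans h); rewrite expr2 ler_wpM2r ?rnorm_ge0//.
- have LB u v : L (u - v) = L u - L v.
    by rewrite addrC -scaleN1r Llin scaleN1r addrC.
  change (x - L x - L (x - L x) = x - Q x).
  rewrite LB; have := LL x => /(congr1 (fun z => 2 *: z)).
  rewrite scalerA mulfV ?scale1r ?pnatr_eq0// => e.
  have -> : L (L x) = 2 *: L x - Q x by rewrite -e addrC addKr.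
  by rewrite scaler_nat mulr2n opprB [_ + _ - _ - _]addrAC addrK addrA subrK.
- change (B (x - L x) = B x - L (B x)); rewrite linearB/=; congr (_ - _).
  suff h : Y n (B x) @[n --> \oo] --> B (L x).
    exact: (cvg_unique _ h (@LE (B x))).
  have Blin : linear B by move=> a u v; rewrite linearP.
  have -> : (fun n => Y n (B x)) = (fun n => B (Y n x)).
    by apply/funext => n; rewrite (Ycomm Blin BQ).
  by apply: continuous_cvg; [exact: cts_fun|exact: LE].
Qed.

End sqrt_iter.

Section psqrt.
Context {R : realType} {H : hilbertType R}.
Implicit Types A B S : boundedOp H H.

Lemma psqrt_exists A : exists S : boundedOp H H, positive_op A ->
  [/\ positive_op S, S \o S =1 A & forall B, commuting B A -> commuting B S].
Proof.
have [A0|] := pselect (positive_op A); last by exists A.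
have [k k0 [_ Qle]] := positive_bound A0.
have kVr : Num.conj k^-1 = k^-1 by rewrite conj_Creal// realV gtr0_real.
pose Qf x := x - k^-1 *: A x.
have Qlin : linear Qf.
  move=> a u v; rewrite /Qf linearP scalerDr scalerBr !scalerA [_ * a]mulrC.
  by rewrite opprD addrACA.
have Qle' x : `|Qf x| <= 1 * `|x| by rewrite mul1r Qle.
pose Q := mkop Qlin ler01 Qle'.
have Qsym x y : inner (Q x) y = inner x (Q y).
  change (inner (x - k^-1 *: A x) y = inner x (y - k^-1 *: A y)).
  by rewrite innerBl innerBr innerZl innerZr kVr (positive_sym A0).
have [S [S0 SS SB]] := sqrt_iter_lim Qsym Qle.
pose c := sqrtC k; have c0 : 0 <= c by rewrite sqrtC_ge0 ltW.
have cr : Num.conj c = c by rewrite conj_Creal// ger0_real.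
pose Sf x := c *: S x.
have Slin : linear Sf.
  by move=> a u v; rewrite /Sf linearP scalerDr !scalerA [_ * a]mulrC.
have [M M0 SM] := op_bound S.
have cM0 : 0 <= c * M by rewrite mulr_ge0// ltW.
have Sle x : `|Sf x| <= (c * M) * `|x|.
  by rewrite /Sf normrZ ger0_norm// -mulrA ler_wpM2l.
exists (mkop Slin cM0 Sle) => _; split => [x|x|B BA x].
- by change (0 <= inner (c *: S x) x); rewrite innerZl mulr_ge0.
- change (c *: S (c *: S x) = A x); rewrite (_ : S (c *: S x) = c *: S (S x)); last exact: linearZ.
  rewrite SS -[Q x]/(x - k^-1 *: A x) opprB addrC subrK !scalerA -expr2 sqrtCK.
  by rewrite mulfV ?gt_eqF// scale1r.
- change (B (c *: S x) = c *: S (B x)); rewrite (_ : B (c *: S x) = c *: B (S x)); last exact: linearZ.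
  congr (_ *: _); apply: SB => z.
  change (B (z - k^-1 *: A z) = B z - k^-1 *: A (B z)).
  rewrite linearB /=; congr (_ - _).
  rewrite (_ : B (k^-1 *: A z) = k^-1 *: B (A z)); last exact: linearZ.
  by congr (_ *: _); exact: BA.
Qed.

(* The unique positive square root when [A] is positive, see [psqrtP] and
   [psqrt_unique]; junk otherwise. *)
Definition psqrt A : boundedOp H H := projT1 (cid (psqrt_exists A)).

Lemma psqrtP A : positive_op A ->
  positive_op (psqrt A) /\ psqrt A \o psqrt A =1 A.
Proof. by move=> A0; rewrite /psqrt; case: cid => S /= /(_ A0)[]. Qed.

Lemma psqrt_unique A B : positive_op A -> positive_op B -> B \o B =1 A ->
  B =1 psqrt A.
Proof.
move=> A0 B0 BB x; rewrite /psqrt; case: cid => S /= /(_ A0)[S0 SS SC].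
have BS : commuting B S.
  by apply: SC => z /=; rewrite -!BB.
set y := S x - B x.
have Dy : S y + B y = 0.
  rewrite /y !linearB/=; have /= -> := SS x; have /= -> := BB x.
  by have /= <- := BS x; rewrite addrA subrK subrr.
have /eqP : inner (S y) y + inner (B y) y = 0 by rewrite -innerDl Dy inner0l.
rewrite paddr_eq0 ?S0 ?B0// => /andP[/eqP Sy /eqP By].
apply/esym/eqP; rewrite -subr_eq0 -/y -inner_eq0 {1}/y innerBl.
rewrite (positive_sym S0) (positive_sym B0).
by rewrite (positive_eq0 S0 Sy) (positive_eq0 B0 By) inner0r subrr.
Qed.

End psqrt.

Record closedSubspace (R : realType) (H : hilbertType R) := ClosedSubspace {
  csub_set :> set H;
  csub_submod : GRing.submod_closed (fun x => x \in csub_set);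
  csub_closed : closed csub_set
}.

Section csub_pred.
Context {R : realType} {H : hilbertType R} (S : closedSubspace H).
Definition csub_pred : pred H := fun x => x \in (S : set H).
HB.instance Definition _ :=
  GRing.isSubmodClosed.Build R[i] H csub_pred (csub_submod S).
End csub_pred.

Section csub_type.
Context {R : realType} {H : hilbertType R}.
Variable (S : closedSubspace H).

Record csub := CSub { csub_val : H; csub_valP : csub_val \in csub_pred S }.

HB.instance Definition _ := [isSub for csub_val].
HB.instance Definition _ := [Choice of csub by <:].
HB.instance Definition _ := [SubChoice_isSubLmodule of csub by <:].

Let norm (x : csub) : R[i] := `|csub_val x|.
Let normD x y : norm (x + y) <= norm x + norm y.
Proof. exact: ler_normD. Qed.
Let normZ l x : norm (l *: x) = `|l| * norm x.
Proof. exact: normrZ. Qed.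
Let norm0 x : norm x = 0 -> x = 0.
Proof. by move/eqP; rewrite normr_eq0 => /eqP x0; exact: val_inj. Qed.
HB.instance Definition _ :=
  Lmodule_isNormed.Build R[i] csub normD normZ norm0.

Lemma csub_complete (F : set_system csub) :
  ProperFilter F -> cauchy F -> cvg F.
Proof.
move=> FF Fc.
have /cauchy_cvgP/cvg_ex[l Fl] : cauchy (csub_val @ F).
  apply/cauchyP => e e0; have /cauchyP/(_ _ e0)[x Fx] := Fc.
  by exists (csub_val x); move: Fx; rewrite -!ball_normE.
have Sl : (S : set H) l.
  have h : \forall x \near F, (S : set H) (csub_val x).
    by apply: nearW => x; have := csub_valP x; rewrite /csub_pred inE.
  exact: (@closed_cvg _ H F _ csub_val (S : set H) (@csub_closed _ _ S) h l Fl).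
apply/cvg_ex; exists (@CSub l (mem_set Sl)).
apply/cvgrPdist_lt => e e0.
have /cvgrPdist_lt/(_ _ e0) := Fl.
exact.
Qed.
HB.instance Definition _ := Uniform_isComplete.Build csub csub_complete.

Definition csub_inner (x y : csub) : R[i] := inner (csub_val x) (csub_val y).
Let csub_bilinear :
  bilinear_for ( *%R : R[i] -> R[i] -> R[i]) (Num.conj \; *%R) csub_inner.
Proof.
split => [y|x] a u v.
  by rewrite /csub_inner innerDl innerZl.
by rewrite /csub_inner innerDr innerZr.
Qed.
HB.instance Definition _ := bilinear_isBilinear.Build R[i] csub csub R[i]
  _ _ csub_inner csub_bilinear.
Let csub_herm x y :
  csub_inner x y = (-1) ^+ false * Num.conj (csub_inner y x).
Proof. by rewrite expr0 mul1r /csub_inner innerC. Qed.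
HB.instance Definition _ := isHermitianSesquilinear.Build R[i] csub false
  Num.conj csub_inner csub_herm.
Let csub_dot x : x != 0 -> 0 < csub_inner x x.
Proof.
by move=> x0; rewrite lt_def inner_ge0 inner_eq0 andbT -(inj_eq val_inj) in x0 *.
Qed.
HB.instance Definition _ := isDotProduct.Build R[i] csub csub_inner csub_dot.
Let csub_inner_norm (x : csub) : csub_inner x x = `|x| ^+ 2.
Proof. exact: inner_norm. Qed.
HB.instance Definition _ := isHilbert.Build R csub csub_inner_norm.
End csub_type.

Section closed_range.
Context {R : realType} {H K : hilbertType R}.
Variable A : boundedOp H K.

Lemma closure_range_submod :
  GRing.submod_closed (fun x => x \in closure (range A)).
Proof.
have clP x : closure (range A) x <->
    forall e : R[i], 0 < e -> exists h, `|x - A h| < e.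
  split=> [cx e e0|cx B /nbhs_normP[e /= e0 eB]].
    have [_ [[h _ <-]]] := cx _ (nbhsx_ballx x _ e0).
    by rewrite -ball_normE; exists h.
  have [h hx] := cx e e0; exists (A h); split; first by exists h.
  exact: eB.
split=> [|a x y]; rewrite ?unfold_in ?inE.
  by apply: subset_closure; exists 0; rewrite ?linear0.
rewrite ?inE => /clP cx /clP cy; apply/clP => e e0.
have a0 : 0 < `|a| + 1 by rewrite ltr_wpDl.
have [h hx] : exists h, `|x - A h| < e / 2 / (`|a| + 1).
  by apply: cx; rewrite !divr_gt0.
have [k ky] : exists k, `|y - A k| < e / 2 by apply: cy; rewrite divr_gt0.
exists (a *: h + k); rewrite linearP opprD addrACA -scalerBr.
rewrite (le_lt_trans (ler_normD _ _))// [e in ltRHS]splitr ler_ltD// normrZ.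
apply: (@le_trans _ _ ((`|a| + 1) * `|x - A h|)).
  by rewrite ler_wpM2r// lerDl.
by rewrite mulrC -ler_pdivlMr// ltW.
Qed.

Definition closed_range : closedSubspace K :=
  ClosedSubspace closure_range_submod (@closed_closure _ (range A)).

Lemma closed_range_mem h : A h \in csub_pred closed_range.
Proof. by apply/mem_set/subset_closure; exists h. Qed.

Definition to_closed_range (h : H) : csub closed_range :=
  CSub (closed_range_mem h).

End closed_range.

Section defs.
Context {R : realType}.
Implicit Types H K : hilbertType R.

(* Operator norm at most 1. *)
Definition contractive H K (T : boundedOp H K) := forall x, `|T x| <= `|x|.

Definition isometric H K (T : boundedOp H K) := forall x, `|T x| = `|x|.

Definition defect H (T : boundedOp H H) : boundedOp H H :=
  psqrt (idfun \- (adj T \o T)).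

Definition defect_space H (T : boundedOp H H) : hilbertType R :=
  csub (closed_range (defect T)).

(* [D_T] with its codomain restricted to the closure of its range. *)
Definition to_defect_space H (T : boundedOp H H) : H -> defect_space T :=
  to_closed_range (defect T).

Lemma defectP H (T : boundedOp H H) : contractive T ->
  positive_op (defect T) /\ forall x, defect T (defect T x) = x - adj T (T x).
Proof.
move=> T1; have [x|D0 DD] := @psqrtP _ _ (idfun \- (adj T \o T)).
  rewrite /= innerBl subr_ge0 -innerC -adjP !inner_norm.
  by rewrite conj_Creal ?rpredX ?normr_real// lerXn2r ?nnegrE.
by split=> // x; exact: DD.
Qed.

(* [T1 - T2^* T = D_T F1 D_T] and [T2 - T1^* T = D_T F2 D_T] for [T = T1 T2]: the
   inner [D_T] maps into the defect space, and [csub_val] includes the defect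
   space back into [H]. *)
Definition fundamental_pair H (T1 T2 : boundedOp H H)
    (F1 F2 : boundedOp (defect_space (T1 \o T2)) (defect_space (T1 \o T2))) :=
  let T : boundedOp H H := T1 \o T2 in
  (forall h, T1 h - adj T2 (T h) =
     defect T (csub_val (F1 (to_defect_space T h)))) /\
  (forall h, T2 h - adj T1 (T h) =
     defect T (csub_val (F2 (to_defect_space T h)))).

Definition lspan H (A : set H) : set H :=
  [set y | exists n (c : 'I_n -> R[i]) (v : 'I_n -> H),
    (forall i, A (v i)) /\ y = \sum_(i < n) c i *: v i].

Definition ando_lift H K (T1 T2 : boundedOp H H) (Pi : boundedOp H K)
    (V1 V2 : boundedOp K K) :=
  [/\ isometric Pi, isometric V1 /\ isometric V2, commuting V1 V2,
      adj V1 \o Pi =1 Pi \o adj T1 & adj V2 \o Pi =1 Pi \o adj T2].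

(* The closed linear span of the [V1^n V2^n (Ran Pi)], with the same power [n] of
   both isometries, is the whole space. *)
Definition strongly_minimal H K (Pi : boundedOp H K) (V1 V2 : boundedOp K K) :=
  closure (lspan (\bigcup_n range (iter n V1 \o iter n V2 \o Pi))) = setT.

End defs.
Arguments fundamental_pair {R H} T1 T2 F1 F2.

(* Main.v *)
(* Write [D = D_T], as an operator from [H] onto a dense subspace of the defect
   space, so that [D^* D = 1 - T^* T].  The key identity is
   [D T1 = F1 D + F2^* D T], and its mirror image.

   If a lift is strongly minimal, then [V = V1 V2] is the minimal isometric lift
   of [T], and [D h |-> V Pi h - Pi T h] extends to an isometry [U] of the defect
   space onto a wandering subspace of [V].  The fundamental operators describe
   [V1] and [V2] on it, [V1 U = U F1 + V U F2^*] and [V2 U = U F2 + V U F1^*], and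
   the four relations express that [V1], [V2] are isometric with product [V].

   Conversely, on the direct sum of [H] and square-summable sequences in the
   defect space, the operators [V1 (h, f) = (T1 h, F2^* D h + F1 f + z F2^* f)] and
   its mirror image [V2] are commuting isometries, and [V1 V2] is the Schaffer
   lift [(h, f) |-> (T h, D h + z f)], which is minimal. *)
Require Import Defs.
From HB Require Import structures.
From mathcomp Require Import all_boot all_order all_algebra sesquilinear.
From mathcomp Require Import complex ring lra.
From mathcomp Require Import all_classical all_reals all_analysis.
Set Implicit Arguments.
Unset Strict Implicit.
Unset Printing Implicit Defensive.
Import Order.TTheory GRing.Theory Num.Theory.
Import numFieldNormedType.Exports.
Local Open Scope classical_set_scope.
Local Open Scope ring_scope.

(** * Adjoints, isometries and density *)

Section operators.
Context {R : realType}.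
Implicit Types H K L : hilbertType R.

Lemma opD H K (A : boundedOp H K) x y : A (x + y) = A x + A y.
Proof. exact: linearD. Qed.
Lemma opB H K (A : boundedOp H K) x y : A (x - y) = A x - A y.
Proof. exact: linearB. Qed.
Lemma op0 H K (A : boundedOp H K) : A 0 = 0.
Proof. exact: linear0. Qed.
Lemma opP H K (A : boundedOp H K) a x y : A (a *: x + y) = a *: A x + A y.
Proof. exact: linearP. Qed.

Lemma rnormZ (H : hilbertType R) a (x : H) :
  rnorm (a *: x) = complex.Re `|a| * rnorm x.
Proof. by apply: complexI; rewrite -rnormE normrZ rnormE rmorphM/= RRe_real. Qed.

Lemma adjPl H K (A : boundedOp H K) x y : inner (adj A x) y = inner x (A y).
Proof. by rewrite -innerC -adjP innerC. Qed.

(** [A^* A - 1] has zero quadratic form, so it is positive and [positive_eq0] makes it vanish; this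
    replaces polarization. *)
Lemma isometric_inner H K (A : boundedOp H K) : isometric A ->
  forall x y, inner (A x) (A y) = inner x y.
Proof.
move=> iA x y; rewrite adjP; congr (inner _ _).
apply/eqP; rewrite -subr_eq0; apply/eqP.
pose B : boundedOp H H := (adj A \o A) \- idfun.
have B0 u : inner (B u) u = 0.
  change (inner (adj A (A u) - u) u = 0).
  by rewrite innerBl adjPl !inner_norm iA subrr.
have Bp : positive_op B by move=> u; rewrite B0.
exact: (positive_eq0 Bp (B0 y)).
Qed.

Lemma inner_continuous H (z : H) : continuous (fun y => inner y z).
Proof.
move=> x; apply/cvgrPdist_lt => e e0.
have d0 : 0 < e / (`|z| + 1) by rewrite divr_gt0// ltr_wpDl.
have : \forall y \near x, `|x - y| < e / (`|z| + 1).
  by have /cvgrPdist_lt := @cvg_id _ (nbhs x); exact.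
apply: filterS => y h; rewrite -innerBl.
apply: le_lt_trans (cauchy_schwarz _ _) _.
apply: (@le_lt_trans _ _ (`|x - y| * (`|z| + 1))).
  by rewrite ler_wpM2l// lerDl.
by rewrite -ltr_pdivlMr// ltr_wpDl.
Qed.

Lemma closure_orthogonal H (A : set H) (z : H) :
  (forall y, A y -> inner y z = 0) -> forall y, closure A y -> inner y z = 0.
Proof.
move=> Az y; have cl : closed ((fun y => inner y z) @^-1` [set 0]).
  apply: closed_comp => [x _|]; first exact: inner_continuous.
  apply: (@accessible_closed_set1 _ (hausdorff_accessible _)).
  exact: (@norm_hausdorff _ R[i]^o).
by move=> /(closureS Az); rewrite -(closure_id _).1.
Qed.

(** The kernel of [A^*] is orthogonal to the range of [A]. Equations in the defect space are later
    proved by applying [D^*] to both sides. *)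
Lemma dense_adj_inj H K (A : boundedOp H K) : closure (range A) = setT ->
  injective (adj A).
Proof.
move=> dA x y e; apply/eqP; rewrite -subr_eq0 -inner_eq0.
rewrite (@closure_orthogonal _ (range A))// ?dA// => _ [h _ <-].
by rewrite adjP opB e subrr inner0r.
Qed.

Lemma eq_on_dense H K L (A : boundedOp H K) (B C : boundedOp K L) :
  closure (range A) = setT -> (forall h, B (A h) = C (A h)) -> B =1 C.
Proof.
move=> dA BC x; apply: inner_inj => y; rewrite !adjP; congr (inner _ _).
apply: (dense_adj_inj dA); apply: inner_inj => h.
by rewrite !adjPl BC.
Qed.

End operators.

(** * Extension of isometries from a dense range *)

Section isometric_extension.
Context {R : realType} {H K L : hilbertType R}.
Variables (A : boundedOp H L) (W : boundedOp H K).
Hypotheses (dA : closure (range A) = setT) (AW : forall h, `|A h| = `|W h|).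

(** Extension by continuity, phrased with a relation closed under limits: linearity and norms are
    proved for the relation, and equality of norms makes it single-valued. *)
Lemma isometric_extension :
  exists2 U : boundedOp L K, isometric U & forall h, U (A h) = W h.
Proof.
have approx (x : L) (e : R) : 0 < e -> exists h, rnorm (x - A h) < e.
  move=> e0; have : closure (range A) x by rewrite dA.
  have e0' : 0 < e%:C%C by rewrite ltcR.
  move=> /(_ _ (nbhsx_ballx x _ e0')) [_ [[h _ <-]]].
  by rewrite -ball_normE /ball_/= rnormE ltcR => xh; exists h.
have AWr h : rnorm (A h) = rnorm (W h) by rewrite /rnorm AW.
have rC (G : hilbertType R) (x y : G) : rnorm (x - y) = rnorm (y - x).
  by rewrite /rnorm distrC.
(* [G x y]: the pair [(x, y)] is in the closure of the graph of [A h |-> W h]. *)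
pose G x y := forall e : R, 0 < e ->
  exists h, rnorm (x - A h) < e /\ rnorm (y - W h) < e.
have GA h : G (A h) (W h).
  by move=> e e0; exists h; rewrite !subrr /rnorm !normr0.
have Gnorm x y : G x y -> rnorm x = rnorm y.
  move=> Gxy; apply/eqP; rewrite eq_le; apply/andP; split.
  - apply/ler_addgt0Pr => e e0; have e20 : 0 < e / 2 by rewrite divr_gt0.
    have [h [h1 h2]] := Gxy _ e20.
    have := rnormD (x - A h) (A h); have := rnormD (W h - y) y.
    by rewrite !subrK AWr rC; lra.
  - apply/ler_addgt0Pr => e e0; have e20 : 0 < e / 2 by rewrite divr_gt0.
    have [h [h1 h2]] := Gxy _ e20.
    have := rnormD (y - W h) (W h); have := rnormD (A h - x) x.
    by rewrite !subrK AWr rC; lra.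
have Glin a x y x' y' : G x y -> G x' y' -> G (a *: x + x') (a *: y + y').
  move=> g g' e e0; pose r := complex.Re `|a|.
  have r0 : 0 <= r by rewrite -lecR RRe_real ?normr_real ?normr_ge0.
  (* The summand 1 covers [a = 0]. *)
  have d0 : 0 < e / 2 / (r + 1) by rewrite !divr_gt0// ltr_wpDl.
  have e20 : 0 < e / 2 by rewrite divr_gt0.
  have [h [h1 h2]] := g _ d0; have [h' [h1' h2']] := g' _ e20.
  have key (E : hilbertType R) (z w z' w' : E) :
      rnorm (z - w) < e / 2 / (r + 1) -> rnorm (z' - w') < e / 2 ->
      rnorm (a *: z + z' - (a *: w + w')) < e.
    rewrite ltr_pdivlMr ?ltr_wpDl// => i i'.
    rewrite opprD addrACA -scalerBr (le_lt_trans (rnormD _ _))// rnormZ.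
    by have := rnorm_ge0 (z - w); lra.
  by exists (a *: h + h'); rewrite !opP; split; apply: key.
have Gfun x y y' : G x y -> G x y' -> y = y'.
  move=> g g'; have := Glin (-1) _ _ _ _ g g'; rewrite !scaleN1r addNr => /Gnorm.
  rewrite [in LHS]/rnorm normr0 => /esym/rnorm_eq0/eqP.
  by rewrite addrC subr_eq0 => /eqP.
have /choice[U GU] x : exists y, G x y.
  (* [A (u n)] tends to [x], and [W (u n)] is Cauchy because [A] and [W] give equal norms to
     differences. *)
  have /choice[u ux] n : exists h, rnorm (x - A h) < n.+1%:R^-1.
    by apply: approx; rewrite invr_gt0.
  have ux_small (e : R) : 0 < e ->
      exists N, forall n, (N <= n)%N -> rnorm (x - A (u n)) < e.
    move=> e0; have [N _ hN] := near_infty_natSinv_lt (PosNum e0).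
    by exists N => n Nn; apply: (lt_trans (ux n)); exact: hN.
  have [e e0|y uy] := hilbert_cauchy (u := W \o u).
    have e20 : 0 < e / 2 by rewrite divr_gt0.
    have [N hN] := ux_small _ e20; exists N => m n Nm Nn /=.
    rewrite -opB -AWr opB; have := hN _ Nm; have := hN _ Nn.
    have := rnormD (A (u m) - x) (x - A (u n)).
    by rewrite addrA subrK (rC _ (A (u m)) x); lra.
  exists y => e e0; have [N hN] := ux_small _ e0.
  have [M hM] := rnorm_cvg uy e0.
  by exists (u (maxn N M)); rewrite hN ?leq_maxl// hM ?leq_maxr.
have Ulin : linear U.
  by move=> a x y; apply: Gfun (GU _) _; apply: Glin.
have Uiso x : `|U x| = `|x| by rewrite !rnormE -(Gnorm _ _ (GU x)).
have Ule x : `|U x| <= 1 * `|x| by rewrite mul1r Uiso.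
exists (mkop Ulin ler01 Ule) => h; first exact: Uiso.
exact: Gfun (GU _) (GA h).
Qed.

End isometric_extension.

(** * Closed spans and orthogonal complements *)

Section orthogonal_complement.
Context {R : realType} {H : hilbertType R}.

Lemma closure_submod (A : set H) :
  GRing.submod_closed (fun x => x \in A) ->
  GRing.submod_closed (fun x => x \in closure A).
Proof.
move=> [A0 AP].
have clP x : closure A x <->
    forall e : R[i], 0 < e -> exists2 y, A y & `|x - y| < e.
  split=> [cx e e0|cx B /nbhs_normP[e /= e0 eB]].
    have [y [Ay]] := cx _ (nbhsx_ballx x _ e0).
    by rewrite -ball_normE; exists y.
  have [y Ay xy] := cx e e0; exists y; split => //.
  exact: eB.
split=> [|a x y]; rewrite ?unfold_in ?inE.
  by apply: subset_closure; move: A0; rewrite ?unfold_in ?inE.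
rewrite ?inE => /clP cx /clP cy; apply/clP => e e0.
have a0 : 0 < `|a| + 1 by rewrite ltr_wpDl.
have [u Au ux] : exists2 u, A u & `|x - u| < e / 2 / (`|a| + 1).
  by apply: cx; rewrite !divr_gt0.
have [v Av vy] : exists2 v, A v & `|y - v| < e / 2.
  by apply: cy; rewrite divr_gt0.
exists (a *: u + v).
  by have := AP a u v; rewrite ?unfold_in ?inE; apply.
rewrite opprD addrACA -scalerBr.
rewrite (le_lt_trans (ler_normD _ _))// [e in ltRHS]splitr ler_ltD// normrZ.
apply: (@le_trans _ _ ((`|a| + 1) * `|x - u|)).
  by rewrite ler_wpM2r// lerDl.
by rewrite mulrC -ler_pdivlMr// ltW.
Qed.

Lemma lspan_submod (A : set H) : GRing.submod_closed (fun x => x \in lspan A).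
Proof.
split=> [|a x y]; rewrite ?unfold_in ?inE.
  exists 0%N, (fun=> 0), (fun=> 0); split; first by case.
  by rewrite big_ord0.
rewrite ?inE => -[n [c [v [Av ->]]]] [m [d [w [Aw ->]]]].
exists (n + m)%N.
exists (fun i => match fintype.split i with inl j => a * c j | inr j => d j end).
exists (fun i => match fintype.split i with inl j => v j | inr j => w j end).
split=> [i|]; first by case: (fintype.split i).
rewrite big_split_ord/= scaler_sumr; congr (_ + _); apply: eq_bigr => i _.
  by rewrite -[lshift m i]/(unsplit (inl i)) unsplitK scalerA.
by rewrite -[rshift n i]/(unsplit (inr i)) unsplitK.
Qed.

(* The Riesz vector in [M] of the functional [inner^~ x] is the orthogonal
   projection of [x]. *)
Lemma csub_total (M : closedSubspace H) :
  (forall x, (forall y, (M : set H) y -> inner y x = 0) -> x = 0) ->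
  (M : set H) = setT.
Proof.
move=> M0; apply/seteqP; split => // x _.
have [p pP] : exists p : csub M, forall y, inner (csub_val y) x = inner y p.
  apply: (@riesz _ _ _ (rnorm x)) => [a u v|u].
    by rewrite /= innerDl innerZl.
  by rewrite mulrC -rnormE; apply: cauchy_schwarz.
have -> : x = csub_val p; last by have := csub_valP p; rewrite /csub_pred inE.
apply/eqP; rewrite -subr_eq0; apply/eqP/M0 => y My.
rewrite innerBr -[y]/(csub_val (CSub (mem_set My : y \in csub_pred M))) pP.
exact: subrr.
Qed.

(** If the span is dense, [z] is orthogonal to itself; the converse is [csub_total]. Minimality of a
    lift thus becomes an orthogonality test. *)
Lemma closure_lspanP (A : set H) : closure (lspan A) = setT <->
  forall z, (forall y, A y -> inner y z = 0) -> z = 0.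
Proof.
split=> [dA z Az|A0].
  apply/eqP; rewrite -inner_eq0; apply/eqP.
  apply: (@closure_orthogonal _ _ (lspan A)); last by rewrite dA.
  move=> _ [n [c [v [Av ->]]]]; elim: n c v Av => [|n IH] c v Av.
    by rewrite big_ord0 inner0l.
  by rewrite big_ord_recr/= innerDl innerZl (Az _ (Av _)) mulr0 addr0 IH.
apply: (@csub_total (ClosedSubspace (closure_submod (@lspan_submod A))
  (@closed_closure _ _))) => x /= Mx.
apply: A0 => y Ay; apply: Mx; apply: subset_closure.
exists 1%N, (fun=> 1), (fun=> y); split => //.
by rewrite big_ord1 scale1r.
Qed.

End orthogonal_complement.

(** * The Hilbert direct sum of a sequence of spaces *)

Section hilbert_sum.
Context {R : realType} {E : nat -> hilbertType R}.
Implicit Types u v w : forall n, E n.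

Definition sqsum u (N : nat) : R := \sum_(i < N) rnorm (u i) ^+ 2.

Definition sq_summable u := exists M, forall N, sqsum u N <= M.

Lemma sqsumS u N : sqsum u N.+1 = sqsum u N + rnorm (u N) ^+ 2.
Proof. by rewrite /sqsum big_ord_recr. Qed.

Lemma sqsum_ge0 u N : 0 <= sqsum u N.
Proof. by apply: sumr_ge0 => i _; exact: sqr_ge0. Qed.

Lemma sqsum_nd u : nondecreasing_seq (sqsum u).
Proof. by apply/nondecreasing_seqP => N; rewrite sqsumS lerDl sqr_ge0. Qed.

Lemma sqsumZ a u N :
  sqsum (fun n => a *: u n) N = complex.Re `|a| ^+ 2 * sqsum u N.
Proof.
by rewrite /sqsum mulr_sumr; apply: eq_bigr => i _; rewrite rnormZ exprMn.
Qed.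

(* Weighted convexity of the square, [(x + y)^2 <= (a + b) (x^2 / a + y^2 / b)]. *)
Lemma sqsumD u v N (a b : R) : 0 < a -> 0 < b ->
  sqsum (fun n => u n + v n) N <= (a + b) * (sqsum u N / a + sqsum v N / b).
Proof.
move=> a0 b0; rewrite /sqsum !mulr_suml -big_split/= mulr_sumr.
apply: ler_sum => i _; have := rnormD (u i) (v i).
move: (rnorm_ge0 (u i + v i)).
move: (rnorm _) (rnorm (u i)) (rnorm (v i)) => z x y z0 h.
have h2 : z ^+ 2 <= (x + y) ^+ 2 by rewrite lerXn2r// nnegrE// (le_trans z0).
apply: (le_trans h2); rewrite -subr_ge0.
suff -> : (a + b) * (x ^+ 2 / a + y ^+ 2 / b) - (x + y) ^+ 2 =
    (b * x - a * y) ^+ 2 / (a * b).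
  by rewrite divr_ge0 ?sqr_ge0// mulr_ge0// ltW.
by field; rewrite !gt_eqF.
Qed.

Lemma sq_summableZ a u : sq_summable u -> sq_summable (fun n => a *: u n).
Proof.
move=> [M uM]; exists (complex.Re `|a| ^+ 2 * M) => N.
by rewrite sqsumZ ler_wpM2l ?sqr_ge0.
Qed.

Lemma sq_summableD u v : sq_summable u -> sq_summable v ->
  sq_summable (fun n => u n + v n).
Proof.
move=> [M uM] [M' vM]; exists ((1 + 1) * (M / 1 + M' / 1)) => N.
apply: (le_trans (sqsumD _ _ _ ltr01 ltr01)).
by rewrite ler_wpM2l// !divr1 lerD.
Qed.

Lemma sq_summableN u : sq_summable u -> sq_summable (fun n => - u n).
Proof.
move=> /(sq_summableZ (-1)) [M uM]; exists M => N; apply: le_trans (uM N).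
by rewrite /sqsum; apply: ler_sum => i _; rewrite scaleN1r.
Qed.

Lemma sq_summable0 : sq_summable (fun n => 0 : E n).
Proof.
exists 0 => N; rewrite /sqsum big1// => i _.
by rewrite /rnorm normr0 expr0n.
Qed.

(** The summands may differ, since the model space has [H] in coordinate 0 and the defect space in
    all others. *)
Record hsum := HSum { hsum_val :> forall n, E n; hsum_valP : sq_summable hsum_val }.
Implicit Types x y z : hsum.

Lemma hsumP x y : (forall n, x n = y n) -> x = y.
Proof.
case: x y => [u uP] [v vP] /= uv.
have {}uv : u = v by exact: functional_extensionality_dep.
by subst v; congr HSum; exact: Prop_irrelevance.
Qed.

HB.instance Definition _ := gen_eqMixin hsum.
HB.instance Definition _ := gen_choiceMixin hsum.

Definition hsum_add x y := HSum (sq_summableD (hsum_valP x) (hsum_valP y)).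
Definition hsum_opp x := HSum (sq_summableN (hsum_valP x)).
Definition hsum_scale a x := HSum (sq_summableZ a (hsum_valP x)).

Let addA : associative hsum_add.
Proof. by move=> x y z; apply: hsumP => n /=; rewrite addrA. Qed.
Let addC : commutative hsum_add.
Proof. by move=> x y; apply: hsumP => n /=; rewrite addrC. Qed.
Let add0 : left_id (HSum sq_summable0) hsum_add.
Proof. by move=> x; apply: hsumP => n /=; rewrite add0r. Qed.
Let addN : left_inverse (HSum sq_summable0) hsum_opp hsum_add.
Proof. by move=> x; apply: hsumP => n /=; rewrite addNr. Qed.
HB.instance Definition _ := GRing.isZmodule.Build hsum addA addC add0 addN.

Let scaleA a b x : hsum_scale a (hsum_scale b x) = hsum_scale (a * b) x.
Proof. by apply: hsumP => n /=; rewrite scalerA. Qed.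
Let scale1 : left_id 1 hsum_scale.
Proof. by move=> x; apply: hsumP => n /=; rewrite scale1r. Qed.
Let scaleDr : right_distributive hsum_scale +%R.
Proof. by move=> a x y; apply: hsumP => n /=; rewrite scalerDr. Qed.
Let scaleDl x : {morph hsum_scale^~ x : a b / a + b}.
Proof. by move=> a b; apply: hsumP => n /=; rewrite scalerDl. Qed.
HB.instance Definition _ :=
  GRing.Zmodule_isLmodule.Build R[i] hsum scaleA scale1 scaleDr scaleDl.

Lemma hsumDE x y n : (x + y) n = x n + y n. Proof. by []. Qed.
Lemma hsumBE x y n : (x - y) n = x n - y n. Proof. by []. Qed.
Lemma hsumZE a x n : (a *: x) n = a *: x n. Proof. by []. Qed.

Lemma sqsum_cvgn x : cvgn (sqsum x).
Proof.
apply: nondecreasing_is_cvgn; first exact: sqsum_nd.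
by have [M xM] := hsum_valP x; exists M => _ [N _ <-].
Qed.

Definition hsum_sq x : R := limn (sqsum x).

Lemma sqsum_le x N : sqsum x N <= hsum_sq x.
Proof. exact: (nondecreasing_cvgn_le (sqsum_nd _) (@sqsum_cvgn x)). Qed.

Lemma hsum_sq_le x M : (forall N, sqsum x N <= M) -> hsum_sq x <= M.
Proof. by move=> xM; apply: limr_le (@sqsum_cvgn x) _; exact: nearW. Qed.

Lemma hsum_sq_ge0 x : 0 <= hsum_sq x.
Proof. exact: le_trans (sqsum_ge0 x 0) (sqsum_le x 0). Qed.

Lemma hsum_sqZ a x : hsum_sq (a *: x) = complex.Re `|a| ^+ 2 * hsum_sq x.
Proof.
apply: cvg_lim => //.
have -> : sqsum (a *: x) = (fun N => complex.Re `|a| ^+ 2 * sqsum x N).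
  by apply/funext => N; exact: sqsumZ.
by apply: cvgMr; exact: sqsum_cvgn.
Qed.

Lemma rnorm_hsum_sq x n : rnorm (x n) ^+ 2 <= hsum_sq x.
Proof. by apply: le_trans (sqsum_le x n.+1); rewrite sqsumS lerDr sqsum_ge0. Qed.

Lemma hsum_sq_eq0 x : hsum_sq x = 0 -> x = 0.
Proof.
move=> x0; apply: hsumP => n; apply: rnorm_eq0; apply/eqP.
by rewrite -sqrf_eq0 eq_le sqr_ge0 andbT -x0 rnorm_hsum_sq.
Qed.

Definition hsum_norm x : R[i] := (Num.sqrt (hsum_sq x))%:C%C.

(** Minkowski's inequality: in [sqsumD] the weights are the two norms [a] and [b], which bounds the
    sum by [(a + b) (a^2 / a + b^2 / b) = (a + b)^2]. The weights must be positive, so zero vectors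
    are treated apart. *)
Let normD x y : hsum_norm (x + y) <= hsum_norm x + hsum_norm y.
Proof.
rewrite /hsum_norm -rmorphD/= lecR.
have := sqrtr_ge0 (hsum_sq x); have := sqrtr_ge0 (hsum_sq y).
have := sqr_sqrtr (hsum_sq_ge0 x); have := sqr_sqrtr (hsum_sq_ge0 y).
set b := Num.sqrt (hsum_sq y); set a := Num.sqrt (hsum_sq x) => bE aE.
rewrite le_eqVlt => /predU1P[b0|b0].
  have -> : y = 0 by apply: hsum_sq_eq0; rewrite -bE -b0 expr0n.
  by rewrite addr0 lerDl b0.
rewrite le_eqVlt => /predU1P[a0|a0].
  have -> : x = 0 by apply: hsum_sq_eq0; rewrite -aE -a0 expr0n.
  by rewrite add0r lerDr a0.
have ab0 : 0 <= a + b by rewrite addr_ge0// ltW.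
rewrite -(@ler_pXn2r _ 2)// ?nnegrE ?sqrtr_ge0//.
rewrite sqr_sqrtr ?hsum_sq_ge0//.
apply: hsum_sq_le => N; apply: (le_trans (sqsumD _ _ _ a0 b0)).
rewrite [leRHS]expr2 ler_wpM2l//.
by rewrite lerD// ler_pdivrMr// -expr2 ?aE ?bE sqsum_le.
Qed.

Let normZ a x : hsum_norm (a *: x) = `|a| * hsum_norm x.
Proof.
have a0 : 0 <= complex.Re `|a| by rewrite -lecR RRe_real ?normr_real ?normr_ge0.
rewrite /hsum_norm hsum_sqZ sqrtrM ?sqr_ge0// sqrtr_sqr rmorphM/=.
by rewrite (ger0_norm a0) RRe_real.
Qed.

Let norm0 x : hsum_norm x = 0 -> x = 0.
Proof.
move=> /complexI/eqP; rewrite sqrtr_eq0 => h; apply: hsum_sq_eq0.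
by apply/eqP; rewrite eq_le h hsum_sq_ge0.
Qed.

HB.instance Definition _ :=
  Lmodule_isNormed.Build R[i] hsum normD normZ norm0.

Lemma hsum_normE x : `|x| = (Num.sqrt (hsum_sq x))%:C%C. Proof. by []. Qed.

Lemma rnorm_hsum x n : rnorm (x n) <= Num.sqrt (hsum_sq x).
Proof.
rewrite -(@ler_pXn2r _ 2)// ?nnegrE ?sqrtr_ge0 ?rnorm_ge0//.
by rewrite sqr_sqrtr ?hsum_sq_ge0// rnorm_hsum_sq.
Qed.

Lemma cvg_rnorm (T : Type) (F : set_system T) {FF : Filter F}
    (H : hilbertType R) (f : T -> H) (l : H) :
  f @ F --> l -> rnorm (f t) @[t --> F] --> rnorm l.
Proof.
move=> /cvgrPdist_lt fl; apply/cvgrPdist_lt => e e0.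
have := fl e%:C%C; rewrite ltcR => /(_ e0); apply: filterS => t.
rewrite rnormE ltcR; apply: le_lt_trans.
have := rnormD (l - f t) (f t); have := rnormD (f t - l) l.
rewrite !subrK; have -> : rnorm (f t - l) = rnorm (l - f t).
  by rewrite /rnorm distrC.
by rewrite ler_norml => h1 h2; apply/andP; split; lra.
Qed.

(** Each coordinate is Cauchy; the family of coordinate limits is square-summable and is the limit
    in norm. *)
Lemma hsum_complete (F : set_system hsum) :
  ProperFilter F -> cauchy F -> cvg F.
Proof.
move=> FF Fc.
have small (e : R) : 0 < e ->
    exists x, \forall y \near F, Num.sqrt (hsum_sq (x - y)) < e.
  move=> e0; have e0' : 0 < e%:C%C by rewrite ltcR.
  have /cauchyP/(_ _ e0')[x Fx] := Fc.
  exists x; move: Fx; apply: filterS => y.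
  by rewrite -ball_normE /ball_/= hsum_normE ltcR.
have clim n : exists l : E n, x n @[x --> F] --> l.
  apply/cvg_ex/cauchy_cvgP/cauchyP => _ /complex_gt0[e e0 ->].
  have [x Fx] := small e e0; exists (x n).
  apply: filterS Fx => y; rewrite -ball_normE /ball_/= rnormE ltcR.
  by apply: le_lt_trans; exact: (rnorm_hsum (x - y)).
pose l n := projT1 (cid (clim n)).
have lE n : x n @[x --> F] --> l n by rewrite /l; case: cid.
have dist x (e : R) N : (\forall y \near F, Num.sqrt (hsum_sq (x - y)) < e) ->
    sqsum (fun n => x n - l n) N <= e ^+ 2.
  move=> Fx.
  (* For fixed [N] the sum is finite, so coordinatewise convergence allows passing to the limit in
     [y]; the bound obtained does not depend on [N]. *)
  have cN : sqsum (x - y) N @[y --> F] --> sqsum (fun n => x n - l n) N.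
    elim: N => [|N IH].
      rewrite [X in _ --> X](_ : _ = 0) /sqsum ?big_ord0//.
      under eq_fun do rewrite big_ord0.
      exact: cvg_cst.
    rewrite sqsumS; under eq_fun do rewrite sqsumS.
    apply: cvgD => //; rewrite expr2; under eq_fun do rewrite expr2.
    have cn : rnorm (x N - y N) @[y --> F] --> rnorm (x N - l N).
      apply: (@cvg_rnorm _ _ _ _ (fun y => x N - y N)).
      by apply: cvgB; [exact: cvg_cst|exact: lE].
    exact: cvgM.
  apply: (cvgr_to_le cN); apply: filterS Fx => y xy.
  apply: (le_trans (sqsum_le _ _)).
  rewrite -[leLHS]sqr_sqrtr ?hsum_sq_ge0// lerXn2r ?nnegrE ?sqrtr_ge0 ?ltW//.
  exact: le_lt_trans (sqrtr_ge0 _) xy.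
have ls : sq_summable l.
  (* [l = x - (x - l)], where both terms are square-summable. *)
  have [x Fx] := small 1 ltr01.
  have s1 : sq_summable (fun n => x n - l n) by exists (1 ^+ 2) => N; exact: dist.
  have := sq_summableD (hsum_valP x) (sq_summableN s1).
  move=> [M lM]; exists M => N; apply: le_trans (lM N).
  by apply: ler_sum => i _; rewrite opprB addrC subrK.
apply/cvg_ex; exists (HSum ls); apply/cvgrPdist_lt => _ /complex_gt0[e e0 ->].
have e20 : 0 < e / 2 by rewrite divr_gt0.
have [x Fx] := small _ e20.
have xl : `|x - HSum ls| <= (e / 2)%:C%C.
  rewrite hsum_normE lecR -(@ler_pXn2r _ 2)// ?nnegrE ?sqrtr_ge0 ?(ltW e20)//.
  by rewrite sqr_sqrtr ?hsum_sq_ge0//; apply: hsum_sq_le => N; exact: dist.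
apply: filterS Fx => y xy.
rewrite -[HSum ls](subrK x) -addrA (le_lt_trans (ler_normD _ _))//.
rewrite [e]splitr rmorphD/= ler_ltD// ?(distrC _ x)// hsum_normE ltcR.
exact: xy.
Qed.

HB.instance Definition _ := Uniform_isComplete.Build hsum hsum_complete.

Definition psum_inner x y (N : nat) : R[i]^o := \sum_(i < N) inner (x i) (y i).

(** By polarization the real part is a difference of convergent partial sums of squares; the
    imaginary part is the real part with [i y] in place of [y]. *)
Lemma psum_inner_cvg x y : exists l : R[i]^o, psum_inner x y @ \oo --> l.
Proof.
have reE (u v : hsum) N : complex.Re (psum_inner u v N) =
    (sqsum (u + v) N - sqsum (u - v) N) / 4.
  rewrite /psum_inner raddf_sum /sqsum -sumrB mulr_suml; apply: eq_bigr => i _.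
  have e1 := rnorm_sqr ((u + v) i); have e2 := rnorm_sqr ((u - v) i).
  move: e1 e2; rewrite hsumDE hsumBE !(innerDl, innerDr, innerNl, innerNr).
  rewrite !rnorm_sqr -(innerC (u i) (v i)); case: (inner (u i) (v i)) => a b.
  move=> /(congr1 (@complex.Re R)) /= e1 /(congr1 (@complex.Re R)) /= e2.
  by rewrite -e1 -e2; simpc => /=; field.
have cre (u v : hsum) :
    exists l : R, complex.Re (psum_inner u v N) @[N --> \oo] --> l.
  exists ((hsum_sq (u + v) - hsum_sq (u - v)) / 4).
  under eq_fun do rewrite reE.
  by apply: cvgMr_tmp; apply: cvgB; exact: sqsum_cvgn.
have [a xa] := cre x y; have [b xb] := cre x (Complex 0 1 *: y).
have imE N : complex.Re (psum_inner x (Complex 0 1 *: y) N) =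
    complex.Im (psum_inner x y N).
  have -> : psum_inner x (Complex 0 1 *: y) N =
      Num.conj (Complex 0 1) * psum_inner x y N.
    by rewrite /psum_inner mulr_sumr; apply: eq_bigr => i _; rewrite hsumZE innerZr.
  by case: (psum_inner x y N) => c d; simpc => /=.
have normc_le (z : R[i]) : `|z| <= `|complex.Re z|%:C%C + `|complex.Im z|%:C%C.
  have {1}-> : z = (complex.Re z)%:C%C + Complex 0 (complex.Im z).
    by case: z => c d; simpc.
  rewrite (le_trans (ler_normD _ _))// !normc_def /= !expr0n.
  by rewrite addr0 add0r !sqrtr_sqr.
exists (Complex a b); apply/cvgrPdist_lt => _ /complex_gt0[e e0 ->].
have e20 : 0 < e / 2 by rewrite divr_gt0.
move/cvgrPdist_lt/(_ _ e20): xa; move/cvgrPdist_lt/(_ _ e20): xb.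
apply: filterS2 => N; rewrite imE => bN aN; apply: (le_lt_trans (normc_le _)).
rewrite -rmorphD/= ltcR [e]splitr !raddfB/=.
exact: ltrD.
Qed.

Definition hsum_inner x y : R[i] := projT1 (cid (psum_inner_cvg x y)).

Lemma hsum_innerP x y : psum_inner x y @ \oo --> (hsum_inner x y : R[i]^o).
Proof. by rewrite /hsum_inner; case: cid. Qed.

Let inner_unique x y (f : nat -> R[i]^o) (l : R[i]^o) :
  f @ \oo --> l -> psum_inner x y =1 f -> hsum_inner x y = l.
Proof.
move=> fl /funext fE; have := @hsum_innerP x y; rewrite fE => h.
exact: (cvg_unique (@norm_hausdorff _ R[i]^o) h fl).
Qed.

Let hsum_bilinear :
  bilinear_for ( *%R : R[i] -> R[i] -> R[i]) (Num.conj \; *%R) hsum_inner.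
Proof.
split=> [y|x] a u v.
  apply: (inner_unique (f := fun N => a * psum_inner u y N + psum_inner v y N)).
    by apply: cvgD; [apply: cvgMl_tmp|]; exact: hsum_innerP.
  move=> N; rewrite /psum_inner mulr_sumr -big_split; apply: eq_bigr => i _.
  by rewrite hsumDE hsumZE innerDl innerZl.
apply: (inner_unique
  (f := fun N => Num.conj a * psum_inner x u N + psum_inner x v N)).
  by apply: cvgD; [apply: cvgMl_tmp|]; exact: hsum_innerP.
move=> N; rewrite /psum_inner mulr_sumr -big_split; apply: eq_bigr => i _.
by rewrite hsumDE hsumZE innerDr innerZr.
Qed.
HB.instance Definition _ := bilinear_isBilinear.Build R[i] hsum hsum R[i]
  _ _ hsum_inner hsum_bilinear.

Let hsum_herm x y :
  hsum_inner x y = (-1) ^+ false * Num.conj (hsum_inner y x).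
Proof.
rewrite expr0 mul1r; apply: (inner_unique (f := fun N => Num.conj (psum_inner y x N))).
  have /cvgrPdist_lt h := @hsum_innerP y x; apply/cvgrPdist_lt => e e0.
  by have := h _ e0; apply: filterS => N; rewrite -rmorphB/= norm_conjC.
by move=> N; rewrite /psum_inner rmorph_sum; apply: eq_bigr => i _; rewrite /= innerC.
Qed.
HB.instance Definition _ := isHermitianSesquilinear.Build R[i] hsum false
  Num.conj hsum_inner hsum_herm.

Let hsum_inner_norm x : hsum_inner x x = `|x| ^+ 2.
Proof.
rewrite hsum_normE -rmorphXn/= sqr_sqrtr ?hsum_sq_ge0//.
apply: (inner_unique (f := fun N => (sqsum x N)%:C%C)).
  have /cvgrPdist_lt h := @sqsum_cvgn x.
  apply/cvgrPdist_lt => _ /complex_gt0[e e0 ->].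
  have := h _ e0; apply: filterS => N; rewrite -rmorphB/= normc_def/=.
  by rewrite expr0n addr0 sqrtr_sqr ltcR.
by move=> N; rewrite /psum_inner rmorph_sum; apply: eq_bigr => i _; rewrite rnorm_sqr.
Qed.

Let hsum_dot x : x != 0 -> 0 < hsum_inner x x.
Proof. by move=> x0; rewrite hsum_inner_norm exprn_gt0 ?normr_gt0. Qed.
HB.instance Definition _ := isDotProduct.Build R[i] hsum hsum_inner hsum_dot.
HB.instance Definition _ := isHilbert.Build R hsum hsum_inner_norm.

(** The partial sums are constant from [N = n + 1] on. *)
Lemma inner_single x y n : (forall m, m != n -> x m = 0) ->
  inner x y = inner (x n) (y n).
Proof.
move=> x0; apply: (inner_unique
    (f := fun N => if (n < N)%N then inner (x n) (y n) else 0)).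
  apply: (@cvg_near_cst _ _ (inner (x n) (y n) : R[i]^o)).
  by exists n.+1 => // N /= nN; rewrite nN.
move=> N; rewrite /psum_inner; case: ltnP => nN.
  rewrite (bigD1 (Ordinal nN))//= big1 ?addr0// => i /eqP ni.
  rewrite x0 ?inner0l//; apply/eqP => e; apply: ni; exact: val_inj.
by rewrite big1// => i _; rewrite x0 ?inner0l// ltn_eqF// (leq_trans _ nN).
Qed.

End hilbert_sum.
Arguments hsum {R} E.

(** * The model space, its isometries and the embedding of [H] *)

Section ando_model.
Context {R : realType} {H L : hilbertType R}.

(* The model space is [H] followed by countably many copies of the defect space
   [L]; with [z] the shift, [model_mul] is multiplication by [F + z G^*] on the
   copies of [L], and sends [h] in [H] to [(S h, G^* D h, 0, ...)]. *)
Definition model_coord (n : nat) : hilbertType R := if n is 0%N then H else L.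

(** The defect-space part of the Schaffer lift: entry [n] here is coordinate [n + 1] of the image of
    [u]. *)
Definition shift_coord (D : boundedOp H L) (u : forall n, model_coord n)
    (n : nat) : L :=
  match n with 0%N => D (u 0%N) | m.+1 => u m.+1 end.

Definition model_mul (S : boundedOp H H) (D : boundedOp H L)
    (F G : boundedOp L L) (u : forall n, model_coord n) n : model_coord n :=
  match n with
  | 0%N => S (u 0%N)
  | m.+1 => adj G (shift_coord D u m) + F (u m.+1)
  end.

Section model_mul.
Variables (S : boundedOp H H) (D : boundedOp H L) (F G : boundedOp L L).
Hypothesis GF : forall x, G (F x) = 0.
Hypothesis FFGG : forall x, adj F (F x) + G (adj G x) = x.
Hypothesis SG : forall h, adj S (S h) + adj D (G (adj G (D h))) = h.

Let normS h : rnorm (S h) ^+ 2 + rnorm (adj G (D h)) ^+ 2 = rnorm h ^+ 2.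
Proof.
apply: complexI; rewrite rmorphD/= -!rnorm_sqr -[X in _ = inner X _](SG h).
by rewrite innerDl !adjPl (adjP G) adjPl.
Qed.

Let normFG x : rnorm (F x) ^+ 2 + rnorm (adj G x) ^+ 2 = rnorm x ^+ 2.
Proof.
apply: complexI; rewrite rmorphD/= -!rnorm_sqr -[X in _ = inner X _](FFGG x).
by rewrite innerDl !adjPl (adjP G) adjPl.
Qed.

(** [G F = 0] makes the ranges of [G^*] and [F] orthogonal. *)
Let normGDF x y :
  rnorm (adj G x + F y) ^+ 2 = rnorm (adj G x) ^+ 2 + rnorm (F y) ^+ 2.
Proof.
have e : inner (adj G x) (F y) = 0 by rewrite adjPl GF inner0r.
apply: complexI; rewrite rmorphD/= -!rnorm_sqr innerDl !innerDr.
by rewrite -[inner (F y) (adj G x)]innerC e rmorph0 addr0 add0r.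
Qed.

(* The partial norms telescope: the last term is what [model_mul] has already
   moved out of coordinate [N]. *)
Lemma sqsum_model_mul u N :
  sqsum (model_mul S D F G u) N.+1 + rnorm (adj G (shift_coord D u N)) ^+ 2 =
  sqsum u N.+1.
Proof.
elim: N => [|N IH]; first by rewrite /sqsum !big_ord1; exact: normS.
rewrite sqsumS [RHS]sqsumS -IH.
have -> : rnorm (u N.+1) ^+ 2 =
    rnorm (F (u N.+1)) ^+ 2 + rnorm (adj G (u N.+1)) ^+ 2 by rewrite normFG.
by rewrite [X in _ + X + _]normGDF !addrA.
Qed.

(** The telescoping identity bounds the partial norms of [u] and of its image by each other, up to
    one index, so the full norms agree. *)
Lemma model_mul_exists :
  exists2 V : boundedOp (hsum model_coord) (hsum model_coord),
  isometric V & forall u n, V u n = model_mul S D F G u n.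
Proof.
have le1 u N : sqsum (model_mul S D F G u) N <= sqsum u N.+1.
  rewrite -sqsum_model_mul; apply: (le_trans (sqsum_nd _ (leqnSn N))).
  by rewrite lerDl sqr_ge0.
(* The term missing from the first [N + 1] image coordinates is an orthogonal component of the next
   one. *)
have le2 u N : sqsum u N <= sqsum (model_mul S D F G u) N.+1.
  case: N => [|N]; first by rewrite [leLHS]big_ord0 sqsum_ge0.
  rewrite -sqsum_model_mul [leRHS]sqsumS lerD2l.
  by rewrite [leRHS]normGDF lerDl sqr_ge0.
have Vs (u : hsum model_coord) : sq_summable (model_mul S D F G u).
  by exists (hsum_sq u) => N; apply: le_trans (le1 _ _) (sqsum_le _ _).
pose V (u : hsum model_coord) := HSum (Vs u).
have lin2 (a : R[i]) (x y z w : L) :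
    a *: x + y + (a *: z + w) = a *: (x + z) + (y + w).
  by rewrite addrACA scalerDr.
have Vlin : linear V.
  by move=> a u v; apply: hsumP => -[|[|n]] /=; rewrite ?hsumDE ?hsumZE ?opP//=.
have Viso u : `|V u| = `|u|.
  rewrite !hsum_normE; congr (Num.sqrt _)%:C%C; apply/eqP; rewrite eq_le.
  apply/andP; split; apply: hsum_sq_le => N.
    exact: le_trans (le1 _ _) (sqsum_le _ _).
  exact: le_trans (le2 _ _) (sqsum_le (V u) _).
have Vle u : `|V u| <= 1 * `|u| by rewrite mul1r Viso.
by exists (mkop Vlin ler01 Vle).
Qed.

End model_mul.

Lemma model_emb_exists : exists2 Pi : boundedOp H (hsum model_coord),
  isometric Pi & forall h, Pi h 0%N = h /\ forall n, Pi h n.+1 = 0.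
Proof.
pose f h n : model_coord n := match n with 0%N => h | _.+1 => 0 end.
have fN h N : sqsum (f h) N.+1 = rnorm h ^+ 2.
  elim: N => [|N IH]; first by rewrite /sqsum big_ord1.
  by rewrite sqsumS IH /= /rnorm normr0 expr0n addr0.
have fs h : sq_summable (f h).
  by exists (rnorm h ^+ 2) => N; rewrite -(fN h N) sqsum_nd.
pose P h := HSum (fs h).
have Plin : linear P.
  by move=> a h k; apply: hsumP => -[|n] //=; rewrite scaler0 addr0.
have Piso h : `|P h| = `|h|.
  rewrite hsum_normE rnormE -[rnorm h]ger0_norm ?rnorm_ge0// -sqrtr_sqr.
  congr (Num.sqrt _)%:C%C; apply/eqP; rewrite eq_le; apply/andP; split.
    by apply: hsum_sq_le => N; rewrite -(fN h N) sqsum_nd.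
  by rewrite -(fN h 0%N); exact: (sqsum_le (P h)).
have Ple h : `|P h| <= 1 * `|h| by rewrite mul1r Piso.
by exists (mkop Plin ler01 Ple).
Qed.

End ando_model.
Arguments model_coord {R} H L n.

(** * How the fundamental operators intertwine with [D] *)

Section fundamental_identities.
Context {R : realType} {H L : hilbertType R}.
Variables (T T1 T2 : boundedOp H H) (D : boundedOp H L) (F1 F2 : boundedOp L L).
Hypotheses (TE : forall h, T h = T1 (T2 h)) (TE' : forall h, T h = T2 (T1 h)).
Hypothesis dD : closure (range D) = setT.
Hypothesis DD : forall h, adj D (D h) = h - adj T (T h).
Hypothesis F1E : forall h, T1 h - adj T2 (T h) = adj D (F1 (D h)).
Hypothesis F2E : forall h, T2 h - adj T1 (T h) = adj D (F2 (D h)).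

Lemma fundamental_adj h : adj D (adj F2 (D h)) = adj T2 h - adj T (T1 h).
Proof.
apply: inner_inj => y.
rewrite !adjPl innerBl !adjPl adjP -F2E innerBr; congr (_ - _).
by rewrite adjP.
Qed.

(** After applying the injective [D^*], the terms [T2^* T h] cancel and what remains is that [T1]
    commutes with [T]. *)
Lemma defect_intertwine h : D (T1 h) = F1 (D h) + adj F2 (D (T h)).
Proof.
apply: (dense_adj_inj dD); rewrite opD DD -F1E fundamental_adj addrA subrK.
by congr (_ - adj T _); rewrite TE TE'.
Qed.

End fundamental_identities.

(** * Consequences of the four relations *)

Section fundamental_multiplier.
Context {R : realType} {H L : hilbertType R}.
Variables (T T1 T2 : boundedOp H H) (D : boundedOp H L) (F1 F2 : boundedOp L L).
Hypotheses (TE : forall h, T h = T1 (T2 h)) (TE' : forall h, T h = T2 (T1 h)).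
Hypothesis dD : closure (range D) = setT.
Hypothesis DD : forall h, adj D (D h) = h - adj T (T h).
Hypothesis F1E : forall h, T1 h - adj T2 (T h) = adj D (F1 (D h)).
Hypothesis F2E : forall h, T2 h - adj T1 (T h) = adj D (F2 (D h)).

(** This is hypothesis [SG] of the model. Applying [F1^*] to [D T1 = F1 D + F2^* D T] kills the last
    term, so [F1^* F1 D = F1^* D T1], and [D^* F1^* D] is known from [fundamental_adj]. *)
Lemma fundamental_compl : (forall x, F2 (F1 x) = 0) ->
  (forall x, adj F1 (F1 x) + F2 (adj F2 x) = x) ->
  forall h, adj T1 (T1 h) + adj D (F2 (adj F2 (D h))) = h.
Proof.
move=> F21 sum1 h.
have F12a x : adj F1 (adj F2 x) = 0.
  by apply: inner_inj => y; rewrite !adjPl F21 inner0r inner0l.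
have e : adj F1 (D (T1 h)) = adj F1 (F1 (D h)).
  by rewrite (defect_intertwine TE TE' dD DD F1E F2E) opD F12a addr0.
have -> : F2 (adj F2 (D h)) = D h - adj F1 (F1 (D h)).
  by rewrite -[X in X - _]sum1 addrC addKr.
rewrite opB DD -e (fundamental_adj F1E) -TE'.
by rewrite opprB addrC addrA !subrK.
Qed.

(** The symbols [F1 + z F2^*] and [F2 + z F1^*] have product [F1 F2 + z (F1 F1^* + F2^* F2) + z^2
    F2^* F1^*], which the relations reduce to [z]. *)
Lemma model_mul_comp (u v : forall n, model_coord H L n) :
  (forall x, F1 (F2 x) = 0) ->
  (forall x, adj F2 (F2 x) + F1 (adj F1 x) = x) ->
  (forall n, v n = model_mul T2 D F2 F1 u n) ->
  forall n, model_mul T1 D F1 F2 v n =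
    match n with 0%N => T (u 0%N) | m.+1 => shift_coord D u m end.
Proof.
move=> F12 sum2 vE [|n] /=; first by rewrite vE TE.
have F21a x : adj F2 (adj F1 x) = 0.
  by apply: inner_inj => y; rewrite !adjPl F12 inner0r inner0l.
have -> : adj F2 (shift_coord D v n) = adj F2 (F2 (shift_coord D u n)).
  (* In the first entry [D T2 = F2 D + F1^* D T] plays the part that the symbol plays in the
     others. *)
  case: n => [|n] /=; rewrite vE /=.
    by rewrite (defect_intertwine TE' TE dD DD F2E F1E) opD F21a addr0.
  by rewrite opD F21a add0r.
by rewrite vE /= opD F12 addr0 sum2.
Qed.

End fundamental_multiplier.

(** * A minimal lift on its wandering subspace *)

Section strongly_minimal_lift.
Context {R : realType} {H K L : hilbertType R}.
Variables (T T1 T2 : boundedOp H H) (D : boundedOp H L) (F1 F2 : boundedOp L L).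
Hypotheses (TE : forall h, T h = T1 (T2 h)) (TE' : forall h, T h = T2 (T1 h)).
Hypothesis dD : closure (range D) = setT.
Hypothesis DD : forall h, adj D (D h) = h - adj T (T h).
Hypothesis F1E : forall h, T1 h - adj T2 (T h) = adj D (F1 (D h)).
Hypothesis F2E : forall h, T2 h - adj T1 (T h) = adj D (F2 (D h)).
Variables (Pi : boundedOp H K) (V V1 V2 : boundedOp K K) (U : boundedOp L K).
Hypotheses (VE : forall k, V k = V1 (V2 k)) (VE' : forall k, V k = V2 (V1 k)).
Hypotheses (iPi : isometric Pi) (iV1 : isometric V1) (iV2 : isometric V2).
Hypotheses (V1Pi : forall h, adj V1 (Pi h) = Pi (adj T1 h))
           (V2Pi : forall h, adj V2 (Pi h) = Pi (adj T2 h)).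
Hypothesis iU : isometric U.
Hypothesis UD : forall h, U (D h) = V (Pi h) - Pi (T h).
Hypothesis minV : forall z, (forall n h, inner (iter n V (Pi h)) z = 0) -> z = 0.

Let iV : isometric V.
Proof. by move=> k; rewrite VE iV1 iV2. Qed.

Let Pi_V1 h k : inner (Pi h) (V1 k) = inner (Pi (adj T1 h)) k.
Proof. by rewrite -V1Pi adjPl. Qed.

Let Pi_V2 h k : inner (Pi h) (V2 k) = inner (Pi (adj T2 h)) k.
Proof. by rewrite -V2Pi adjPl. Qed.

Let Pi_V h k : inner (Pi h) (V k) = inner (Pi (adj T h)) k.
Proof.
rewrite VE Pi_V1 Pi_V2; congr (inner (Pi _) _); apply: inner_inj => y.
by rewrite !adjPl TE.
Qed.

Let inner_UD h y : inner (U (D h)) y = inner (V (Pi h)) y - inner (Pi (T h)) y.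
Proof. by rewrite UD innerBl. Qed.

(** Tested on the dense vectors [D k]: [V^* Pi = Pi T^*] cancels the two terms of [U (D k)]. *)
Let Pi_U h x : inner (Pi h) (U x) = 0.
Proof.
rewrite -innerC adjP; have -> : adj U (Pi h) = 0; last first.
  by rewrite inner0r rmorph0.
apply: (dense_adj_inj dD); rewrite op0; apply: inner_inj => k.
rewrite !adjPl inner0l UD innerBr Pi_V !isometric_inner// adjPl.
exact: subrr.
Qed.

(** [V^*] sends [V Pi h - Pi T h] to [Pi (h - T^* T h) = Pi D^* D h]. *)
Let adjV_U x : adj V (U x) = Pi (adj D x).
Proof.
apply: (eq_on_dense (A := D) (B := adj V \o U) (C := Pi \o adj D)) => // h.
rewrite /= UD opB DD opB; congr (_ - _).
  by apply: inner_inj => y; rewrite adjPl isometric_inner.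
by apply: inner_inj => y; rewrite adjPl Pi_V.
Qed.

Let U_V x y : inner (U x) (V y) = inner (Pi (adj D x)) y.
Proof. by rewrite -adjV_U adjPl. Qed.

Let Pi_VU n h x : inner (Pi h) (iter n V (U x)) = 0.
Proof. by elim: n h => [|n IH] h; rewrite /= ?Pi_U// Pi_V. Qed.

(** The range of [U] is wandering: [V^*] maps it into the range of [Pi], which is orthogonal to
    every [V^n U]. *)
Let U_VU n x y : inner (U x) (iter n.+1 V (U y)) = 0.
Proof. by rewrite /= U_V Pi_VU. Qed.

Let V1_V2 x y : inner (V1 x) (V y) = inner x (V2 y).
Proof. by rewrite VE isometric_inner. Qed.

Let Pi_V1U h x : inner (Pi h) (V1 (U x)) = 0.
Proof. by rewrite Pi_V1 Pi_U. Qed.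

Let V1Pi_Pi h k : inner (V1 (Pi h)) (Pi k) = inner (T1 h) k.
Proof. by rewrite adjP V1Pi isometric_inner// adjP. Qed.

(** Against [U (D h)], the identity [V1^* V = V2] produces [T2 h - T1^* T h], that is
    [D^* F2 D h]. *)
Let V1Pi_U k y : inner (V1 (Pi k)) (U y) = inner (adj F2 (D k)) y.
Proof.
rewrite -adjPl; suff -> : adj U (V1 (Pi k)) = adj F2 (D k) by [].
apply: (dense_adj_inj dD); apply: inner_inj => h.
rewrite !adjPl UD innerBr V1_V2 V1Pi_Pi Pi_V2 isometric_inner// adjPl.
by rewrite (adjP D) -F2E innerBr adjP.
Qed.

(** On [x = D h], [U^* V1] turns [V Pi h] into [D T1 h] and [Pi T h] into [F2^* D T h]; their
    difference is [F1 D h]. *)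
Let V1U_U x y : inner (V1 (U x)) (U y) = inner (F1 x) y.
Proof.
rewrite -adjPl; congr (inner _ _).
apply: (eq_on_dense (A := D) (B := adj U \o (V1 \o U)) (C := F1)) => // h.
apply: inner_inj => {}y; rewrite /= adjPl UD opB innerBl VE' -VE adjP adjV_U.
rewrite V1Pi_Pi -adjP V1Pi_U -innerBl; congr (inner _ _).
by rewrite (defect_intertwine TE TE' dD DD F1E F2E) addrK.
Qed.

Let V1U_VU x y : inner (V1 (U x)) (V (U y)) = inner (adj F2 x) y.
Proof.
rewrite -[LHS](adjPl (V \o U)); congr (inner _ _).
apply: (eq_on_dense (A := D) (B := adj (V \o U) \o (V1 \o U))
  (C := adj F2)) => // h.
apply: inner_inj => {}y; rewrite /= adjPl /= V1_V2 inner_UD -V1_V2 VE' -VE.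
by rewrite Pi_V2 Pi_U subr0 isometric_inner// V1Pi_U.
Qed.

(* The vectors [V^n U y] and [Pi h] together span what the [V^n Pi h] span, so
   both sides are compared against them. *)
Lemma lift_on_wandering x : V1 (U x) = U (F1 x) + V (U (adj F2 x)).
Proof.
apply/eqP; rewrite -subr_eq0; apply/eqP/minV => n h.
suff wand m y : inner (iter m V (U y))
    (V1 (U x) - (U (F1 x) + V (U (adj F2 x)))) = 0.
  elim: n h => [|n IH] h.
    by rewrite /= innerBr innerDr Pi_V1U Pi_U (Pi_VU 1) addr0 subrr.
  (* From [V Pi h = Pi T h + U D h], so induction on [n] reduces the test to the vectors
     [V^m U y]. *)
  have -> : iter n.+1 V (Pi h) = iter n V (Pi (T h)) + iter n V (U (D h)).
    rewrite iterSr UD; set a := V (Pi h); rewrite -[a in LHS](subrK (Pi (T h))).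
    elim: n {IH} => [|n /= ->]; first by rewrite /= addrC.
    by rewrite opD.
  by rewrite innerDl IH wand addr0.
(* [m = 0] detects the coefficient [F1], [m = 1] detects [F2^*], and for larger [m] all terms
   vanish. *)
rewrite innerBr innerDr; case: m => [|[|m]] /=.
- rewrite (U_VU 0) addr0 isometric_inner// -[X in X - _]innerC V1U_U innerC.
  exact: subrr.
- rewrite -[inner (V (U y)) (U _)]innerC (U_VU 0) rmorph0 add0r.
  rewrite (isometric_inner iV) (isometric_inner iU) -innerC V1U_VU innerC.
  exact: subrr.
- have -> : inner (V (V (iter m V (U y)))) (V1 (U x)) = 0.
    rewrite -innerC V1_V2 -/(iter m.+1 V (U y)).
    have -> : V2 (iter m.+1 V (U y)) = V (V2 (iter m V (U y))).
      by rewrite /= [in LHS]VE -[in LHS]VE' VE' -VE.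
    by rewrite U_V Pi_V2 Pi_VU rmorph0.
  rewrite -[inner _ (U _)]innerC (U_VU m.+1) (isometric_inner iV).
  by rewrite -[inner _ (U _)]innerC (U_VU m) rmorph0 addr0 subrr.
Qed.

(** [V1 U] is isometric, and its components in the ranges of [U] and [V U] are orthogonal. *)
Lemma lift_adj_sum x : adj F1 (F1 x) + F2 (adj F2 x) = x.
Proof.
apply: inner_inj => y; rewrite innerDl adjPl (adjP F2).
have := isometric_inner iV1 (U x) (U y); rewrite (isometric_inner iU) => <-.
rewrite !lift_on_wandering innerDl !innerDr !(isometric_inner iV).
rewrite !(isometric_inner iU) (U_VU 0) -[inner (V _) (U _)]innerC (U_VU 0).
by rewrite rmorph0 addr0 add0r.
Qed.

(** [U^* V1 V2 U = U^* V U = 0]. Expanding [V2 U] leaves [U^* V1 U F2 = F1 F2], since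
    [U^* V1 V U = D Pi^* V1 U = 0]. *)
Lemma lift_prod0 : (forall x, V2 (U x) = U (F2 x) + V (U (adj F1 x))) ->
  forall x, F1 (F2 x) = 0.
Proof.
move=> V2U x; apply: inner_inj => y; rewrite inner0l -V1U_U.
rewrite -(addrK (V (U (adj F1 x))) (U (F2 x))) -V2U opB -VE innerBl.
rewrite -innerC (U_VU 0) rmorph0 sub0r VE' -VE -innerC U_V.
by rewrite Pi_V1U rmorph0 oppr0.
Qed.

End strongly_minimal_lift.

(** * Strong minimality in terms of [V = V1 V2] *)

Section strongly_minimal_iter.
Context {R : realType} {H K : hilbertType R}.
Variables (Pi : boundedOp H K) (V V1 V2 : boundedOp K K).
Hypotheses (VE : forall k, V k = V1 (V2 k)) (VE' : forall k, V k = V2 (V1 k)).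

Lemma iter_commuting n k : iter n V1 (iter n V2 k) = iter n V k.
Proof.
elim: n k => [|n IH] k //=.
have -> : iter n V1 (V2 (iter n V2 k)) = V2 (iter n V1 (iter n V2 k)).
  by elim: {IH} n (iter n V2 k) => [|n IH] j //=; rewrite IH -VE VE'.
by rewrite -VE IH.
Qed.

(** Equal powers give [V1^n V2^n = V^n], so only the product matters. *)
Lemma strongly_minimalP : strongly_minimal Pi V1 V2 <->
  forall z, (forall n h, inner (iter n V (Pi h)) z = 0) -> z = 0.
Proof.
rewrite /strongly_minimal closure_lspanP; split=> h0 z hz; apply: h0.
  by move=> _ [n _ [h _ <-]]; rewrite /= iter_commuting hz.
by move=> n h; apply: hz; exists n => //; exists h => //=; rewrite iter_commuting.
Qed.

End strongly_minimal_iter.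

(** * The two implications, for an abstract defect operator [D] *)

Section fundamental_lift.
Context {R : realType} {H L : hilbertType R}.
Variables (T T1 T2 : boundedOp H H) (D : boundedOp H L) (F1 F2 : boundedOp L L).
Hypotheses (TE : forall h, T h = T1 (T2 h)) (TE' : forall h, T h = T2 (T1 h)).
Hypothesis dD : closure (range D) = setT.
Hypothesis DD : forall h, adj D (D h) = h - adj T (T h).
Hypothesis F1E : forall h, T1 h - adj T2 (T h) = adj D (F1 (D h)).
Hypothesis F2E : forall h, T2 h - adj T1 (T h) = adj D (F2 (D h)).

Let adjT h : adj T h = adj T2 (adj T1 h).
Proof. by apply: inner_inj => y; rewrite !adjPl TE. Qed.

Lemma lift_fundamental (K : hilbertType R) (Pi : boundedOp H K)
    (V1 V2 : boundedOp K K) :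
  ando_lift T1 T2 Pi V1 V2 -> strongly_minimal Pi V1 V2 ->
  [/\ forall x, F1 (F2 x) = 0, forall x, F2 (F1 x) = 0,
      forall x, adj F1 (F1 x) + F2 (adj F2 x) = x &
      forall x, adj F2 (F2 x) + F1 (adj F1 x) = x].
Proof.
move=> [iPi [iV1 iV2] V12 V1Pi V2Pi].
pose V : boundedOp K K := V1 \o V2.
have VE k : V k = V1 (V2 k) by [].
have VE' k : V k = V2 (V1 k) by exact: V12.
move/(strongly_minimalP _ VE VE') => minV.
pose W : boundedOp H K := (V \o Pi) \- (Pi \o T).
have WE h : W h = V (Pi h) - Pi (T h) by [].
have VPiPi h k : inner (V (Pi h)) (Pi k) = inner (T h) k.
  rewrite VE adjP [adj V1 _](V1Pi k) adjP [adj V2 _](V2Pi _).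
  by rewrite isometric_inner// -adjT adjP.
(* As [Pi^* V Pi = T], both squared norms equal [|h|^2 - |T h|^2]. *)
have DW h : `|D h| = `|W h|.
  apply/eqP; rewrite -(@eqrXn2 _ 2)//; apply/eqP.
  rewrite -!inner_norm adjP DD WE innerBr !innerBl !innerBr.
  rewrite VE !(isometric_inner iV1, isometric_inner iV2) -VE VPiPi.
  rewrite -[inner (Pi (T h)) (V _)]innerC VPiPi innerC.
  by rewrite !(isometric_inner iPi) -adjP subrr subr0.
have [U iU UD] := isometric_extension dD DW.
have UD' h : U (D h) = V (Pi h) - Pi (T h) by rewrite UD.
have U1 := lift_on_wandering TE TE' dD DD F1E F2E VE VE' iPi iV1 iV2 V1Pi V2Pi
  iU UD' minV.
(* [T], [V] and [U] are unchanged when the indices 1 and 2 are exchanged. *)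
have U2 := lift_on_wandering TE' TE dD DD F2E F1E VE' VE iPi iV2 iV1 V2Pi V1Pi
  iU UD' minV.
split.
- exact: (lift_prod0 TE TE' dD DD F1E F2E VE VE' iPi iV1 iV2 V1Pi V2Pi UD' U2).
- exact: (lift_prod0 TE' TE dD DD F2E F1E VE' VE iPi iV2 iV1 V2Pi V1Pi UD' U1).
- exact: (lift_adj_sum TE TE' dD DD F1E F2E VE VE' iPi iV1 iV2 V1Pi V2Pi
    iU UD' minV).
- exact: (lift_adj_sum TE' TE dD DD F2E F1E VE' VE iPi iV2 iV1 V2Pi V1Pi
    iU UD' minV).
Qed.

Lemma model_lift_exists :
  (forall x, F1 (F2 x) = 0) -> (forall x, F2 (F1 x) = 0) ->
  (forall x, adj F1 (F1 x) + F2 (adj F2 x) = x) ->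
  (forall x, adj F2 (F2 x) + F1 (adj F1 x) = x) ->
  exists (K : hilbertType R) (Pi : boundedOp H K) (V1 V2 : boundedOp K K),
    ando_lift T1 T2 Pi V1 V2 /\ strongly_minimal Pi V1 V2.
Proof.
move=> F12 F21 sum1 sum2.
have cpl1 := fundamental_compl TE TE' dD DD F1E F2E F21 sum1.
have cpl2 := fundamental_compl TE' TE dD DD F2E F1E F12 sum2.
have [V1 iV1 V1E] := model_mul_exists F21 sum1 cpl1.
have [V2 iV2 V2E] := model_mul_exists F12 sum2 cpl2.
have [Pi iPi PiE] := @model_emb_exists R H L.
pose V : boundedOp (hsum (model_coord H L)) (hsum (model_coord H L)) := V1 \o V2.
have VnE u n : V u n =
    match n with 0%N => T (u 0%N) | m.+1 => shift_coord D u m end.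
  rewrite [LHS]V1E.
  exact: (model_mul_comp TE TE' dD DD F1E F2E F12 sum2 (V2E u)).
(* Both products are the Schaffer lift. *)
have VE' u : V u = V2 (V1 u).
  apply: hsumP => n; rewrite VnE V2E; apply/esym.
  exact: (model_mul_comp TE' TE dD DD F2E F1E F21 sum1 (V1E u)).
have inner_Pi h (z : hsum (model_coord H L)) :
    inner (Pi h) z = inner h (z 0%N : H).
  rewrite (@inner_single _ _ (Pi h) z 0%N) => [|[//|n] _].
    by rewrite (PiE h).1.
  exact: (PiE h).2.
exists (hsum (model_coord H L) : hilbertType R), Pi, V1, V2; split.
  split=> // h; apply: inner_inj => y /=.
    by rewrite adjPl !inner_Pi V1E /= adjPl.
  by rewrite adjPl !inner_Pi V2E /= adjPl.
have VE u : V u = V1 (V2 u) by [].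
apply/(strongly_minimalP _ VE VE') => z hz.
apply: hsumP => -[|n].
  apply: inner_inj => h; rewrite -[LHS]innerC -inner_Pi (hz 0%N) rmorph0.
  exact/esym/inner0l.
(* These vectors carry [D h] in a single coordinate; pairing them with [z] shows that [D^*] kills
   every coordinate of [z] beyond the first. *)
have iterE h m : iter m V (V (Pi h) - Pi (T h)) m.+1 = D h /\
    forall k, k != m.+1 -> iter m V (V (Pi h) - Pi (T h)) k = 0.
  elim: m => [|m [IH1 IH2]].
    split=> [|[|[|k]] // _]; rewrite [iter 0 _ _]/= hsumBE VnE.
    - by rewrite /= (PiE h).1 (PiE _).2 subr0.
    - by rewrite /= (PiE h).1 (PiE _).1 subrr.
    - by rewrite /= (PiE h).2 (PiE _).2 subrr.
  split=> [|[|[|k]] km]; rewrite [iter m.+1 _ _]/= VnE /=.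
  - exact: IH1.
  - by rewrite (IH2 0%N)// op0.
  - by rewrite (IH2 0%N)// op0.
  - by rewrite IH2.
apply: (dense_adj_inj dD); apply: inner_inj => h.
rewrite op0 inner0l adjPl -[LHS]innerC -(iterE h n).1.
rewrite -(@inner_single _ _ _ z n.+1 (iterE h n).2).
have -> : iter n V (V (Pi h) - Pi (T h)) = iter n.+1 V (Pi h) - iter n V (Pi (T h)).
  rewrite iterSr; elim: n {iterE} => [|n IH] //.
  by rewrite iterS IH opB.
by rewrite innerBl !hz subrr rmorph0.
Qed.

End fundamental_lift.

(** * The defect operator as a map into the defect space *)

Section defect_space_op.
Context {R : realType} {H : hilbertType R}.
Variable T : boundedOp H H.

(** [defect T] is self-adjoint, so the adjoint of its corestriction is [defect T] after the
    inclusion; the equations of [fundamental_pair] then take the form [D^* F D]. *)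
Lemma defect_op_exists : contractive T ->
  exists D : boundedOp H (defect_space T),
  [/\ forall h, D h = to_defect_space T h, closure (range D) = setT,
      forall h, adj D (D h) = h - adj T (T h) &
      forall x, adj D x = defect T (csub_val x)].
Proof.
move=> Tc; have [D0 DD] := defectP Tc.
have Dlin : linear (to_defect_space T).
  by move=> a x y; apply: val_inj; rewrite /= opP.
have [M M0 DM] := op_bound (defect T).
have DM' h : `|to_defect_space T h| <= M * `|h| by exact: DM.
pose D : boundedOp H (defect_space T) := mkop Dlin (ltW M0) DM'.
have DE h : D h = to_defect_space T h by [].
have adjE x : adj D x = defect T (csub_val x).
  apply: inner_inj => y; rewrite adjPl (positive_sym D0); exact: erefl.
exists D; split => // [|h]; last by rewrite adjE DE /= DD.
apply/seteqP; split => // x _ B /nbhs_normP[e /= e0 eB].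
have := csub_valP x; rewrite /csub_pred inE.
move=> /(_ _ (nbhsx_ballx _ _ e0)) [_ [[h _ <-]]]; rewrite -ball_normE => xh.
by exists (D h); split; [exists h | apply: eB].
Qed.

End defect_space_op.

Theorem theorem4p7p4 (R : realType) (H : hilbertType R)
    (T1 T2 : boundedOp H H) (T12 : commuting T1 T2)
    (T1c : contractive T1) (T2c : contractive T2)
    (F1 F2 : boundedOp (defect_space (T1 \o T2)) (defect_space (T1 \o T2)))
    (F12 : fundamental_pair T1 T2 F1 F2) :
  (exists (K : hilbertType R) (Pi : boundedOp H K) (V1 V2 : boundedOp K K),
     ando_lift T1 T2 Pi V1 V2 /\ strongly_minimal Pi V1 V2) <->
  (F1 \o F2 =1 (fun=> 0) /\ F2 \o F1 =1 (fun=> 0)) /\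
  ((forall x, adj F1 (F1 x) + F2 (adj F2 x) = x) /\
   (forall x, F1 (adj F1 x) + adj F2 (F2 x) = x)).
Proof.
pose T : boundedOp H H := T1 \o T2.
have TE h : T h = T1 (T2 h) by [].
have TE' h : T h = T2 (T1 h) by exact: T12.
have Tc : contractive T by move=> h; apply: le_trans (T1c _) (T2c _).
have [D [DE dD DD adjE]] := defect_op_exists Tc.
have [F1E F2E] := F12.
have {}F1E h : T1 h - adj T2 (T h) = adj D (F1 (D h)) by rewrite adjE DE F1E.
have {}F2E h : T2 h - adj T1 (T h) = adj D (F2 (D h)) by rewrite adjE DE F2E.
split=> [[K [Pi [V1 [V2 [lift smin]]]]]|[[p12 p21] [s1 s2]]].
  have [p12 p21 s1 s2] := lift_fundamental TE TE' dD DD F1E F2E lift smin.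
  by split=> //; split=> // x; rewrite addrC s2.
have {}s2 x : adj F2 (F2 x) + F1 (adj F1 x) = x by rewrite addrC s2.
exact: (model_lift_exists TE TE' dD DD F1E F2E).
Qed.
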